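(* Let $(x^k)_{k\ge 0}$ be generated by the ARock algorithm for a nonexpansive operator $T:\mathbb{H}\to\mathbb{H}$ with at least one fixed point, under the following conditions: 1. The block sequence $i(0),i(1),\ldots$ is a sequence of IID random variables, uniform on $\{1,\ldots,m\}$. 2. The sequence of delay vectors $\vec{j}(0),\vec{j}(1),\vec{j}(2),\ldots$ is an arbitrary (deterministic) sequence in $\mathbb{N}^m$, independent of the block sequence, with $\liminf_k j(k)<\infty$. 3. $\epsilon_1,\epsilon_2,\ldots\in(0,\infty)$ is an arbitrary sequence of parameters such that $\sum_{l=1}^{\infty}\epsilon_l<\infty$. 4. The step size is $\eta^k=c\,h_{j(k)}$ for some arbitrary fixed $c\in(0,1)$ and $$h_j=\left(1+\frac{1}{m}\sum_{i=1}^{\infty}\epsilon_i+\sum_{i=1}^{j}\frac{1}{\epsilon_i}\right)^{-1}.$$ Then with probability $1$ the sequence of ARock iterates converges weakly to a solution on subsequences of bounded delay; that is, with probability $1$ there is $x^*\in\mathrm{Fix}(T)$ such that the iterates converge weakly to $x^*$ along every subsequence $Q_J$ with $J\ge\liminf_k j(k)$.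
   Context: $\mathbb{H}$ is a separable Hilbert space, decomposed into $m$ orthogonal subspaces $\mathbb{H}=\mathbb{H}_1\times\cdots\times\mathbb{H}_m$; write $x=(x_1,\ldots,x_m)$ with $x_i\in\mathbb{H}_i$. $T:\mathbb{H}\to\mathbb{H}$ is nonexpansive: $\|Tx-Ty\|\le\|x-y\|$. $\mathrm{Fix}(T)$ is its set of fixed points; a solution is an element of $\mathrm{Fix}(T)$. $S=I-T$, and $S_ix$ is the $i$-th block of $Sx$. $\mathbb{N}=\{0,1,2,\ldots\}$. ARock algorithm: given a starting point $x^0\in\mathbb{H}$, step lengths $\eta^0,\eta^1,\ldots$, block indices $i(k)\in\{1,\ldots,m\}$ and delay vectors $\vec{j}(k)=(j(k,1),\ldots,j(k,m))\in\mathbb{N}^m$, define for $k=0,1,2,\ldots$ and $i=1,\ldots,m$: $x_i^{k+1}=x_i^k-\eta^kS_i(\hat{x}^k)$ if $i=i(k)$, and $x_i^{k+1}=x_i^k$ if $i\ne i(k)$. The delayed iterate is $\hat{x}^k=x^{k-\vec{j}(k)}$, where $x^{k-\vec{j}}=(x_1^{k-j_1},\ldots,x_m^{k-j_m})$ and $x^n=x^0$ for $n<0$. The current delay is $j(k)=\max_{1\le i\le m}j(k,i)$. Subsequences of bounded delay: $Q_J$ is the subsequence of $x^0,x^1,x^2,\ldots$ obtained by removing the iterates $x^k$ with current delay $j(k)>J$; for $J\ge\liminf_k j(k)$ it is an infinite subsequence. *)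

(* Defs.v *)
(* MathComp-Analysis *)
From HB Require Import structures.
From mathcomp Require Export all_boot all_order all_algebra.
From mathcomp Require Export all_classical all_reals all_analysis.
Export Order.TTheory GRing.Theory Num.Theory.
Export numFieldNormedType.Exports.

Set Implicit Arguments.
Unset Strict Implicit.
Unset Printing Implicit Defensive.

#[export] Set Implicit Arguments.
#[export] Unset Strict Implicit.
#[export] Unset Printing Implicit Defensive.

Local Open Scope classical_set_scope.
Local Open Scope ring_scope.

Section Hilbert.
Variables (R : realType) (H : completeNormedModType R).
Variable dot : {dot H for idfun}.

(* Makes [dot] the inner product of the complete normed space [H], so that
   [H] is a real Hilbert space. *)
Definition induces_norm : Prop := forall x : H, `|x| ^+ 2 = dot x x.

Definition separable : Prop := exists2 D : set H, countable D & dense D.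

Definition weak_cvg (u : nat -> H) (l : H) : Prop :=
  forall y : H, dot (u n) y @[n --> \oo] --> dot l y.

Definition subspace (V : set H) : Prop :=
  V 0 /\ forall (a : R) (u v : H), V u -> V v -> V (a *: u + v).

Definition is_decomposition m (E : 'I_m -> set H) (x : H) (y : 'I_m -> H) :
    Prop :=
  (forall b, E b (y b)) /\ x = \sum_b y b.

(* The summands are closed: each one is the orthogonal complement of the sum
   of the others. *)
Definition orthogonal_decomposition m (E : 'I_m -> set H) : Prop :=
  [/\ forall b, subspace (E b),
      forall b b' : 'I_m, b != b' ->
        forall u v : H, E b u -> E b' v -> dot u v = 0
    & forall x, exists y, is_decomposition E x y].

End Hilbert.

Section Operators.
Variables (R : realType) (H : completeNormedModType R).

Definition nonexpansive (T : H -> H) : Prop :=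
  forall x y, `|T x - T y| <= `|x - y|.

Definition fixed_points (T : H -> H) : set H := [set x | T x = x].

End Operators.

Section ARock.
Variables (R : realType) (H : completeNormedModType R) (m : nat).
Variable E : 'I_m -> set H.

(* [block x b] is the component $x_b$ of [x]; the default value is irrelevant
   when [E] is an orthogonal decomposition. *)
Definition block (x : H) : 'I_m -> H :=
  xget (fun=> 0) [set y | is_decomposition E x y].

(* Truncated subtraction on nat implements $x^n = x^0$ for $n < 0$. *)
Definition delayed (x : nat -> H) (k : nat) (jv : 'I_m -> nat) : H :=
  \sum_b block (x (k - jv b)%N) b.

Definition arock (S : H -> H) (x0 : H) (eta : nat -> R) (i : nat -> 'I_m)
    (j : nat -> 'I_m -> nat) (x : nat -> H) : Prop :=
  x 0%N = x0 /\
  forall (k : nat) (b : 'I_m),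
    block (x k.+1) b =
      if b == i k then block (x k) b - eta k *: block (S (delayed x k (j k))) b
      else block (x k) b.

End ARock.

Lemma block_unique (R : realType) (H : completeNormedModType R) (dot : {dot H for idfun})
  (hdot : induces_norm dot) m (E : 'I_m -> set H) (hE : orthogonal_decomposition dot E) x y :
  is_decomposition E x y -> block E x = y.
Proof.
case: hE => Esub Eort Eex dy; rewrite /block.
case: xgetP => [z _ dz|/(_ y) //].
apply/funext => b; apply/eqP; rewrite -subr_eq0 -normr_eq0 -(sqrf_eq0 `|_|) hdot.
have Ed b' : E b' (z b' - y b').
  rewrite addrC -scaleN1r; apply: (Esub b').2; [exact: dy.1|exact: dz.1].
have s0 : \sum_b' (z b' - y b') = 0 by rewrite sumrB -dz.2 -dy.2 subrr.
have : dot (z b - y b) (\sum_b' (z b' - y b')) = 0 by rewrite s0 linear0r.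
rewrite linear_sumr (bigD1 b) //= big1 ?addr0; first by move=> ->.
by move=> b' bb'; apply: Eort (Ed _) (Ed _); rewrite eq_sym.
Qed.

Definition cur_delay m (j : nat -> 'I_m -> nat) (k : nat) : nat :=
  \max_(b < m) j k b.

Definition liminf_delay (R : realType) m (j : nat -> 'I_m -> nat) : \bar R :=
  limn_einf (fun k => (cur_delay j k)%:R%:E).

(* The index of the n-th iterate (counting from 0) whose current delay is at
   most J; the default value 0 is only used when there are at most n of them. *)
Definition bounded_delay_index m (j : nat -> 'I_m -> nat) (J n : nat) : nat :=
  xget 0%N [set k | (cur_delay j k <= J)%N /\
                    count (fun l => cur_delay j l <= J)%N (iota 0 k) = n].

Lemma bounded_delay_index_enum m (j : nat -> 'I_m -> nat) J :
  (forall N, exists2 k, (N <= k)%N & (cur_delay j k <= J)%N) ->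
  increasing_seq (bounded_delay_index j J) /\
  range (bounded_delay_index j J) = [set k | (cur_delay j k <= J)%N].
Proof.
move=> inf; set p := fun l => (cur_delay j l <= J)%N.
have cS k : count p (iota 0 k.+1) = (count p (iota 0 k) + p k)%N.
  by rewrite -addn1 iotaD count_cat /= addn0.
have cmono a b : (a <= b)%N -> (count p (iota 0 a) <= count p (iota 0 b))%N.
  by move=> ab; rewrite -(subnKC ab) iotaD count_cat leq_addr.
have ex n : exists k, p k /\ count p (iota 0 k) = n.
  elim: n => [|n [k [pk ck]]].
    have [k0 _ pk0] := inf 0%N; have ex0 : exists k, p k by exists k0.
    exists (ex_minn ex0); case: ex_minnP => k pk mk; split=> //.
    apply/eqP; rewrite -leqn0 leqNgt -has_count; apply/negP => /hasP[l].
    by rewrite mem_iota /= add0n => lk /mk; rewrite leqNgt lk.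
  have [k0 kk0 pk0] := inf k.+1.
  have ex0 : exists k', (k < k')%N && p k' by exists k0; rewrite kk0.
  exists (ex_minn ex0); case: ex_minnP => k' /andP[kk' pk'] mk; split=> //.
  rewrite -(subnKC kk') iotaD count_cat cS ck pk addn1 add0n.
  suff -> : count p (iota k.+1 (k' - k.+1)) = 0%N by rewrite addn0.
  apply/eqP; rewrite -leqn0 leqNgt -has_count; apply/negP => /hasP[l].
  rewrite mem_iota subnKC // => /andP[kl lk'] pl.
  by have := mk l; rewrite kl pl => /(_ isT); rewrite leqNgt lk'.
have iP n : p (bounded_delay_index j J n) /\
    count p (iota 0 (bounded_delay_index j J n)) = n.
  by rewrite /bounded_delay_index; case: xgetP => [//|]; have [k ?] := ex n; move/(_ k).
split.
  apply/increasing_seqP => n; rewrite ltEnat /= ltnNge; apply/negP => /cmono.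
  by rewrite !(iP _).2 ltnn.
apply/seteqP; split => [_ [n _ <-]|k /= pk]; first exact: (iP n).1.
exists (count p (iota 0 k)) => //.
have [] := iP (count p (iota 0 k)); set k' := bounded_delay_index _ _ _ => pk' e.
case: (ltngtP k k') => // lt; have := cmono _ _ lt; rewrite cS e.
  by rewrite /p pk addn1 ltnn.
by rewrite pk' addn1 ltnn.
Qed.

(* $Q_J$ *)
Definition bounded_delay_subseq (U : Type) m (j : nat -> 'I_m -> nat) (J : nat)
    (x : nat -> U) : nat -> U :=
  x \o bounded_delay_index j J.

(* [eps] is indexed from 1; [eps 0] plays no role. *)
Definition step_h (R : realType) (m : nat) (eps : nat -> R) (j : nat) : R :=
  (1 + m%:R^-1 * limn (fun n : nat => \sum_(1 <= l < n) eps l)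
     + \sum_(1 <= l < j.+1) (eps l)^-1)^-1.

Section IID.
Context {d : measure_display} {Omega : measurableType d} {R : realType}.
Variable P : probability Omega R.

Definition mutually_independent (U : Type) (X : nat -> Omega -> U) : Prop :=
  forall (F : seq nat) (B : nat -> set U), uniq F ->
    P (\bigcap_(k in [set` F]) X k @^-1` B k) =
      (\prod_(k <- F) P (X k @^-1` B k))%E.

(* [U] carries the discrete sigma-algebra. *)
Definition iid_uniform (U : finType) (X : nat -> Omega -> U) : Prop :=
  [/\ forall k (B : set U), measurable (X k @^-1` B),
      forall k (b : U), P (X k @^-1` [set b]) = (#|U|%:R^-1)%:E
    & mutually_independent X].

End IID.

(* Main.v *)
Require Import Defs.
From mathcomp Require Import ring lra.

Local Open Scope classical_set_scope.
Local Open Scope ring_scope.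

(* For a fixed point p, write t_l for the tail sum of eps_i over i >= l. The
   function |x^k - p|^2 + m^-1 sum_(n < k) t_(k-n) |x^(n+1) - x^n|^2 decreases in
   conditional expectation by at least m^-1 (1 - c) eta^k |S xhat^k|^2: averaging
   over the uniform block turns the update into a full step, S is
   1/2-cocoercive, and the delay error is absorbed by Young's inequality with
   weights eps_l, which is what the step size is designed for. The iterates after
   k steps depend on finitely many letters, so supermartingales are functions of
   words. Ville's maximal inequality on words and a buy-low-sell-high strategy
   show that the Lyapunov function converges and that the decrements are summable
   almost surely. Hence |x^k - p| converges for all p in a countable dense subset
   of Fix(T), so for all p in Fix(T), while x^k - T x^k tends to 0 along indices
   of bounded delay. Opial's argument then identifies the weak limit; weak cluster
   points are obtained as asymptotic centers along ultrafilters. *)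

(** * Hilbert spaces and blocks *)

Section InnerProduct.
Variables (R : realType) (H : completeNormedModType R).
Variable dot : {dot H for idfun}.
Hypothesis hdot : induces_norm dot.
Implicit Types (u v w x y : H) (a : R).

Lemma dotC u v : dot u v = dot v u.
Proof. by rewrite hermitian_subproof expr0 mul1r. Qed.

Lemma dotZl a u v : dot (a *: u) v = a * dot u v.
Proof. by rewrite linearZl_LR. Qed.

Lemma dotZr a u v : dot u (a *: v) = a * dot u v.
Proof. by rewrite dotC dotZl dotC. Qed.

Lemma dotBl u v w : dot (u - v) w = dot u w - dot v w.
Proof. by rewrite dotC linearB /= !(dotC w). Qed.

Lemma sqnormD u v : `|u + v| ^+ 2 = `|u| ^+ 2 + 2 * dot u v + `|v| ^+ 2.
Proof. by rewrite !hdot linearDl !linearDr /= (dotC v u); ring. Qed.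

Lemma sqnormB u v : `|u - v| ^+ 2 = `|u| ^+ 2 - 2 * dot u v + `|v| ^+ 2.
Proof. by rewrite sqnormD linearNr /= normrN; ring. Qed.

Lemma sqnormZ a u : `|a *: u| ^+ 2 = a ^+ 2 * `|u| ^+ 2.
Proof. by rewrite normrZ exprMn real_normK // num_real. Qed.

Lemma parallelogram u v :
  `|u - v| ^+ 2 = 2 * `|u| ^+ 2 + 2 * `|v| ^+ 2 - `|u + v| ^+ 2.
Proof. by rewrite sqnormB sqnormD; ring. Qed.

(** Expand |a u - v|^2 >= 0 and divide by [a]. *)
Lemma dot_young a u v : 0 < a ->
  2 * dot u v <= a * `|u| ^+ 2 + a^-1 * `|v| ^+ 2.
Proof.
move=> a0; have := sqr_ge0 `|a *: u - v|.
rewrite sqnormB sqnormZ dotZl => h.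
rewrite -subr_ge0 -(pmulr_rge0 _ a0) (le_trans h) // le_eqVlt.
by apply/orP; left; apply/eqP; field; rewrite gt_eqF.
Qed.

(** This is the 1/2-cocoercivity of I - T, tested against its zero [p]: T x - p = (x - p) - (x - T
    x) has norm at most |x - p|, and expanding its square leaves the inequality. *)
Lemma firmly_nonexpansive_residual (T : H -> H) x p :
  nonexpansive T -> T p = p -> `|x - T x| ^+ 2 <= 2 * dot (x - p) (x - T x).
Proof.
move=> hT Tp; have := hT x p; rewrite Tp -(@ler_pXn2r _ 2) ?nnegrE // => h.
have := sqnormB (x - p) (x - T x).
by rewrite opprB [x - p + _]addrC addrA subrK => e; lra.
Qed.

(** I - T is 2-Lipschitz; this carries a small residual from the delayed iterate to the current
    one. *)
Lemma residual_lipschitz (T : H -> H) x y : nonexpansive T ->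
  `|x - T x| <= `|y - T y| + 2 * `|x - y|.
Proof.
move=> hT.
have -> : x - T x = (y - T y) + ((x - y) + (T y - T x)).
  by rewrite addrACA [y + _]addrC subrK addKr.
rewrite (le_trans (ler_normD _ _)) // lerD2l (le_trans (ler_normD _ _)) //.
by have := hT y x; rewrite (distrC y x); lra.
Qed.

(** * Coordinates with respect to the orthogonal decomposition *)

Section Blocks.
Variables (m : nat) (E : 'I_m -> set H).
Hypothesis hE : orthogonal_decomposition dot E.

Lemma block_decomposition x : is_decomposition E x (block E x).
Proof. by have [_ _ /(_ x)[y dy]] := hE; rewrite (block_unique hdot hE dy). Qed.

Lemma sum_block x : \sum_b block E x b = x.
Proof. by rewrite -(block_decomposition x).2. Qed.

Lemma blockZD a x y b : block E (a *: x + y) b = a *: block E x b + block E y b.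
Proof.
suff /(block_unique hdot hE) -> :
  is_decomposition E (a *: x + y) (fun b => a *: block E x b + block E y b) by [].
have [[dx ex] [dy ey]] := (block_decomposition x, block_decomposition y).
split=> [b'|]; first by have [/(_ b')[_ h] _ _] := hE; apply: h.
by rewrite big_split -scaler_sumr -ex -ey.
Qed.

Lemma blockB x y b : block E (x - y) b = block E x b - block E y b.
Proof. by rewrite addrC -scaleN1r blockZD scaleN1r addrC. Qed.

Lemma block0 b : block E 0 b = 0.
Proof. by have := blockB 0 0 b; rewrite !subrr. Qed.

Lemma block_sum (I : Type) (r : seq I) (F : I -> H) b :
  block E (\sum_(n <- r) F n) b = \sum_(n <- r) block E (F n) b.
Proof.
elim: r => [|n r ih]; first by rewrite !big_nil block0.
by rewrite !big_cons -ih -[F n]scale1r blockZD !scale1r.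
Qed.

Lemma block_sum_in (y : 'I_m -> H) b :
  (forall b', E b' (y b')) -> block E (\sum_b' y b') b = y b.
Proof. by move=> Ey; rewrite (block_unique hdot hE (y := y)). Qed.

Lemma dot_block x y : dot x y = \sum_b dot (block E x b) (block E y b).
Proof.
rewrite dotC -{1}(sum_block x) linear_sumr /=; apply: eq_bigr => b _.
rewrite dotC -{1}(sum_block y) linear_sumr /= (bigD1 b) //= big1 ?addr0 // => b' nb.
rewrite dotC.
have [_ h _] := hE; apply: (h _ _ nb); exact: (block_decomposition _).1.
Qed.

Lemma sqnorm_block x : `|x| ^+ 2 = \sum_b `|block E x b| ^+ 2.
Proof. by rewrite hdot dot_block; apply: eq_bigr => b _; rewrite hdot. Qed.

Lemma norm_block_le x b : `|block E x b| <= `|x|.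
Proof.
rewrite -(@ler_pXn2r _ 2) ?nnegrE // (sqnorm_block x) (bigD1 b) //= lerDl.
by apply: sumr_ge0 => *; rewrite exprn_ge0.
Qed.

Lemma block_delayed (u : nat -> H) k jv b :
  block E (delayed E u k jv) b = block E (u (k - jv b)%N) b.
Proof.
by rewrite /delayed block_sum_in // => b'; apply: (block_decomposition _).1.
Qed.

End Blocks.
End InnerProduct.

(** * Weak convergence *)

(** Compactness of [-M, M] gives a cluster point of the image of [U], and a cluster point of an
    ultrafilter is a limit. *)
Lemma ultra_bounded_cvg (R : realType) (I : Type) (U : set_system I) (f : I -> R) (M : R) :
  UltraFilter U -> (\forall n \near U, `|f n| <= M) -> cvg (f n @[n --> U]).
Proof.
move=> UU fM.
have Uf : (f @ U) `[- M, M]%classic.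
  by apply: filterS fM => n; rewrite /= in_itv /= -ler_norml.
have [p [_ clp]] := @segment_compact R (- M) M (f @ U) _ Uf.
apply/cvg_ex; exists p => V Vp.
have [//|UVc] := in_ultra_setVsetC (f @^-1` V) UU.
have /(_ (~` V) V) := clp; rewrite /meets /=.
by move=> /(_ UVc Vp)[y []].
Qed.

(** If some neighbourhood [V] of [l] failed, the trace of [F] on the complement of the preimage of
    [V] would be a proper filter, and an ultrafilter refining it would avoid [V]. *)
Lemma cvg_ultra (I : Type) (T : topologicalType) (F : set_system I) (f : I -> T) (l : T) :
  Filter F ->
  (forall U, UltraFilter U -> F `<=` U -> f n @[n --> U] --> l) ->
  f n @[n --> F] --> l.
Proof.
move=> FF hU V Vl; apply: contrapT => nFV.
pose G := within (~` (f @^-1` V)) F.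
have PG : ProperFilter G.
  apply: Build_ProperFilter_ex => A GA; apply: contrapT => nA; apply: nFV.
  have {}GA : F [set n | ~ V (f n) -> A n] := GA.
  apply: (@filterS _ F) GA => n /= An; apply: contrapT => nV; apply: nA.
  by exists n; apply: An.
have [U [UU GU]] := ultraFilterLemma PG.
have FU : F `<=` U.
  by move=> A FA; apply: GU; apply: filterS FA => n An _.
have UV : U (f @^-1` V) by exact: (hU U UU FU V Vl).
have UnV : U (~` (f @^-1` V)) by apply: GU; apply: nearW => n.
have /filter_ex[n []//] : U (f @^-1` V `&` ~` (f @^-1` V)) by apply: filterI.
Qed.

Section WeakLimits.
Variables (R : realType) (H : completeNormedModType R).
Variable dot : {dot H for idfun}.
Hypothesis hdot : induces_norm dot.

(* [r y] is the radius of the asymptotic ball of [u] around [y] along [U]; its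
   minimizer is the asymptotic center. *)
Section Center.
Variables (U : set_system nat) (u : nat -> H) (r : H -> R).
Hypothesis UU : UltraFilter U.
Hypothesis ur : forall y, `|u n - y| @[n --> U] --> r y.

Let UP : ProperFilter U := ultra_proper.

Lemma radius_sqr y : `|u n - y| ^+ 2 @[n --> U] --> r y ^+ 2.
Proof. by rewrite expr2; under eq_cvg do rewrite expr2; apply: cvgM; apply: ur. Qed.

Lemma radius_ge0 y : 0 <= r y.
Proof. by apply: (cvgr_to_ge (@ur y)); apply: nearW => n. Qed.

Lemma radius_lip y z : r y <= r z + `|z - y|.
Proof.
have h : `|u n - z| + `|z - y| @[n --> U] --> r z + `|z - y|.
  by apply: cvgD (@ur z) (cvg_cst _).
apply: (ler_cvg_to (@ur y) h); apply: nearW => n.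
by rewrite -(subrKA z) ler_normD.
Qed.

(** Limit along [U] of the parallelogram identity for u n - z and u n - y, whose half-sum is [u n]
    minus the midpoint of [y] and [z]. It makes the squared radius uniformly convex. *)
Lemma radius_parallelogram y z :
  `|y - z| ^+ 2 = 2 * r y ^+ 2 + 2 * r z ^+ 2 - 4 * r (2^-1 *: (y + z)) ^+ 2.
Proof.
set w := 2^-1 *: _.
have h : 2 * `|u n - y| ^+ 2 + 2 * `|u n - z| ^+ 2 - 4 * `|u n - w| ^+ 2 @[n --> U] -->
    2 * r y ^+ 2 + 2 * r z ^+ 2 - 4 * r w ^+ 2.
  apply: cvgB; last by apply: cvgMl_tmp; apply: radius_sqr.
  by apply: cvgD; apply: cvgMl_tmp; apply: radius_sqr.
apply: (cvg_unique (@Rhausdorff R) _ h).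
suff -> : (fun n => 2 * `|u n - y| ^+ 2 + 2 * `|u n - z| ^+ 2 - 4 * `|u n - w| ^+ 2)
   = (fun=> `|y - z| ^+ 2) by exact: cvg_cst.
apply/funext => n; have := parallelogram hdot (u n - z) (u n - y).
have -> : u n - z - (u n - y) = y - z by rewrite opprB addrC subrKA.
move=> ->; have -> : u n - z + (u n - y) = 2 *: (u n - w).
  rewrite scalerBr /w scalerA mulfV // scale1r scaler_nat mulr2n.
  by rewrite addrACA opprD [- z - y]addrC.
by rewrite sqnormZ; ring.
Qed.

(** A minimizing sequence is Cauchy: by the parallelogram identity two near-minimizers are close,
    since their midpoint cannot have radius below the infimum [I]. Completeness and the Lipschitz
    bound on [r] finish. *)
Lemma radius_minimizer : exists v, forall y, r v <= r y.
Proof.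
pose I := inf (range r).
have hI : has_inf (range r).
  split; first by exists (r 0); exists 0.
  by exists 0 => _ [y _ <-]; apply: radius_ge0.
have Ile y : I <= r y by apply: ge_inf; [exact: hI.2|exists y].
have I0 : 0 <= I.
  by apply: lb_le_inf; [exact: hI.1|move=> _ [y _ <-]; apply: radius_ge0].
have /choice[y hy] : forall n, exists y, r y < I + n.+1%:R^-1.
  move=> n; have [|_ [y _ <-] ?] := @inf_adherent R (range r) n.+1%:R^-1 _ hI; last by exists y.
  by rewrite invr_gt0.
have cy : cauchy (y @ \oo).
  apply: cauchy_exP => e e0.
  (* For points of radius at most I + a the squared distance is at most 4 (I + a)^2 - 4 I^2 = 8 I a
     + 4 a^2, hence at most a (8 I + 4) once a < 1. *)
  have d0 : 0 < Num.min 1 (e ^+ 2 / (8 * I + 4)).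
    by rewrite lt_min ltr01 divr_gt0 ?exprn_gt0 //; lra.
  have [N _ hN] := near_infty_natSinv_lt (PosNum d0).
  exists (y N); exists N => // n /= Nn; rewrite -ball_normE /=.
  rewrite -(@ltr_pXn2r _ 2) ?nnegrE // ?ltW //.
  set a : R := N.+1%:R^-1.
  have [] : a < 1 /\ a * (8 * I + 4) < e ^+ 2.
    have := hN N (leqnn N); rewrite /= lt_min -/a => /andP[-> ].
    by rewrite ltr_pdivlMr ?(lt_le_trans _ (lerDr _ _)) //; lra.
  have a0 : 0 < a by rewrite invr_gt0.
  have yb k : (N <= k)%N -> r (y k) ^+ 2 <= (I + a) ^+ 2.
    move=> Nk; rewrite ler_pXn2r ?nnegrE ?radius_ge0 // ?addr_ge0 ?(ltW a0) //.
    apply: (le_trans (ltW (hy k))); rewrite lerD2l lef_pV2 ?posrE //.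
    by rewrite ler_nat.
  have := yb _ (leqnn N); have := yb _ Nn.
  have : I ^+ 2 <= r (2^-1 *: (y N + y n)) ^+ 2.
    by rewrite ler_pXn2r ?nnegrE ?radius_ge0.
  rewrite radius_parallelogram => h1 h2 h3 h4 h5; nra.
have /cauchy_cvg yv := cy; exists (lim (y @ \oo)) => z.
apply: le_trans (Ile z).
set v := lim _ in yv *.
have h : I + n.+1%:R^-1 + `|y n - v| @[n --> \oo] --> I + 0 + 0.
  apply: cvgD; first by apply: cvgD; [exact: cvg_cst|exact: cvg_harmonic].
  by rewrite -(normr0 H) -(subrr v); apply: cvg_norm; apply: cvgB => //; exact: cvg_cst.
rewrite !addr0 in h; apply: (cvgr_to_ge h); apply: nearW => n.
by apply: le_trans (radius_lip _ (y n)) _; rewrite lerD2r ltW.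
Qed.

End Center.

(** Weak compactness of bounded sets, in ultrafilter form. The weak limit is the asymptotic center
    [v]: inner products converge by polarization, and minimality of [v] forces the limit of <u n -
    v, y> to vanish. *)
Lemma ultra_weak_cvg (U : set_system nat) (u : nat -> H) (M : R) :
  UltraFilter U -> (\forall n \near U, `|u n| <= M) ->
  exists v, forall y, dot (u n) y @[n --> U] --> dot v y.
Proof.
move=> UU uM; have UP : ProperFilter U by exact: ultra_proper.
have /choice[r ur] : forall y, exists l : R, `|u n - y| @[n --> U] --> l.
  move=> y; apply/cvg_ex/(ultra_bounded_cvg (M := M + `|y|)); apply: filterS uM => n un.
  by rewrite normr_id (le_trans (ler_normB _ _)) // lerD2r.
have [v vmin] := radius_minimizer UU ur.
exists v => y.
pose f n := `|u n - (v - y)| ^+ 2 - `|u n - v| ^+ 2.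
have dE : (fun n => dot (u n) y) = fun n => dot v y + 2^-1 * (f n - `|y| ^+ 2).
  apply/funext => n; rewrite /f opprB [y - v]addrC addrA (sqnormD hdot (u n - v)) dotBl.
  by field.
have [l hl] : exists l : R, dot (u n - v) y @[n --> U] --> l.
  exists (2^-1 * (r (v - y) ^+ 2 - r v ^+ 2 - `|y| ^+ 2)).
  have : dot (u n) y - dot v y @[n --> U] --> dot v y + 2^-1 * (r (v - y) ^+ 2 - r v ^+ 2 - `|y| ^+ 2) - dot v y.
    apply: cvgB; last exact: cvg_cst.
    rewrite dE; apply: cvgD; first exact: cvg_cst.
    apply: cvgMl_tmp; apply: cvgB; last exact: cvg_cst.
    by apply: cvgB; apply: radius_sqr.
  by rewrite addrC addKr; under eq_cvg do rewrite -dotBl.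
(* First-order optimality: compare the radius at [v] with the radius at v + t y. *)
have key t : 2 * t * l <= t ^+ 2 * `|y| ^+ 2.
  have h : `|u n - v| ^+ 2 - 2 * t * dot (u n - v) y + t ^+ 2 * `|y| ^+ 2 @[n --> U] -->
      r v ^+ 2 - 2 * t * l + t ^+ 2 * `|y| ^+ 2.
    apply: cvgD; last exact: cvg_cst.
    by apply: cvgB; [exact: radius_sqr|exact: cvgMl_tmp].
  have h' : `|u n - (v + t *: y)| ^+ 2 @[n --> U] --> r (v + t *: y) ^+ 2.
    exact: radius_sqr.
  have e : r (v + t *: y) ^+ 2 = r v ^+ 2 - 2 * t * l + t ^+ 2 * `|y| ^+ 2.
    apply: (cvg_unique (@Rhausdorff R) h').
    move: h; apply: cvg_trans; apply: near_eq_cvg; apply: nearW => n.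
    by rewrite opprD addrA (sqnormB hdot (u n - v)) dotZr sqnormZ; ring.
  have : r v ^+ 2 <= r (v + t *: y) ^+ 2.
    by rewrite ler_pXn2r ?nnegrE ?(radius_ge0 UU ur).
  by rewrite e; lra.
suff l0 : l = 0.
  have : dot (u n - v) y + dot v y @[n --> U] --> l + dot v y.
    by apply: cvgD => //; exact: cvg_cst.
  rewrite l0 add0r.
  by under eq_cvg do rewrite dotBl /= subrK.
apply/eqP; rewrite -sqrf_eq0 eq_le sqr_ge0 andbT.
have s0 : 0 < `|y| ^+ 2 + 1 by rewrite ltr_wpDl // exprn_ge0.
(* With t = l / (|y|^2 + 1) the inequality becomes 2 l^2 (|y|^2 + 1) <= l^2 |y|^2, which forces l =
   0; the added 1 covers y = 0. *)
have := key (l / (`|y| ^+ 2 + 1)).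
set s := `|y| ^+ 2 in s0 *.
have -> : 2 * (l / (s + 1)) * l = (2 * l ^+ 2 * (s + 1)) / (s + 1) ^+ 2.
  by field; rewrite gt_eqF.
have -> : (l / (s + 1)) ^+ 2 * s = (l ^+ 2 * s) / (s + 1) ^+ 2.
  by field; rewrite gt_eqF.
rewrite ler_pM2r ?invr_gt0 ?exprn_gt0 //.
have : 0 <= s by apply: exprn_ge0.
by have := sqr_ge0 l; nra.
Qed.

(** Nonexpansiveness gives |u n - T v| <= |u n - T (u n)| + |u n - v|. Squaring, and expanding the
    left side around [v], bounds |v - T v|^2 by terms that vanish through the residual or through
    weak convergence. *)
Lemma demiclosed (F : set_system nat) (u : nat -> H) (T : H -> H) (M : R) v :
  ProperFilter F -> nonexpansive T -> (\forall n \near F, `|u n| <= M) ->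
  (forall y, dot (u n) y @[n --> F] --> dot v y) ->
  u n - T (u n) @[n --> F] --> 0 -> T v = v.
Proof.
move=> FF hT uM uv uT.
apply/esym/eqP; rewrite -subr_eq0 -normr_eq0 -sqrf_eq0 eq_le sqr_ge0 andbT.
pose s n := `|u n - T (u n)|.
have s0 : s n @[n --> F] --> (0 : R) by apply/norm_cvg0P.
have h : s n * s n + 2 * (M + `|v|) * s n - 2 * (dot (u n) (v - T v) - dot v (v - T v))
    @[n --> F] --> 0 * 0 + 2 * (M + `|v|) * 0 - 2 * (dot v (v - T v) - dot v (v - T v)).
  apply: cvgB.
    by apply: cvgD; [exact: cvgM|exact: cvgMl_tmp].
  by apply: cvgMl_tmp; apply: cvgB; [exact: uv|exact: cvg_cst].
rewrite subrr !mulr0 addr0 subr0 in h.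
apply: (cvgr_to_ge h); apply: filterS uM => n un.
have h1 : `|u n - T v| <= s n + `|u n - v|.
  rewrite -(subrKA (T (u n))) (le_trans (ler_normD _ _)) // lerD2l.
  exact: hT.
have h2 : `|u n - T v| ^+ 2 = `|u n - v| ^+ 2 + 2 * dot (u n - v) (v - T v) + `|v - T v| ^+ 2.
  by rewrite -(sqnormD hdot) addrA subrK.
have h3 : `|u n - v| <= M + `|v| by rewrite (le_trans (ler_normB _ _)) // lerD2r.
have h4 : `|u n - T v| ^+ 2 <= (s n + `|u n - v|) ^+ 2.
  by rewrite ler_pXn2r ?nnegrE ?addr_ge0 /s.
have h5 : 0 <= s n by exact: normr_ge0.
by rewrite -dotBl; nra.
Qed.

(** Opial's lemma for filters; [p] is chosen before [F], so one limit serves all index sets on which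
    the residual vanishes. Demiclosedness puts the weak limits along ultrafilters into Fix(T), and
    the convergent distances make them coincide. *)
Lemma opial (T : H -> H) (u : nat -> H) :
  nonexpansive T -> fixed_points T !=set0 ->
  (forall p, fixed_points T p -> cvgn (fun n => `|u n - p|)) ->
  exists2 p, fixed_points T p &
    forall F, ProperFilter F -> \oo `<=` F -> u n - T (u n) @[n --> F] --> 0 ->
      forall y, dot (u n) y @[n --> F] --> dot p y.
Proof.
move=> hT [p0 Tp0] ucvg.
have [M uM] : exists M : R, \forall n \near \oo, `|u n| <= M.
  have /cvg_ex[/= l hl] := ucvg p0 Tp0; exists (l + 1 + `|p0|).
  have : \forall n \near \oo, `|u n - p0| <= l + 1 by apply: cvgr_le hl _ _; rewrite ltrDl.
  apply: filterS => n un.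
  by rewrite -(subrK p0 (u n)) (le_trans (ler_normD _ _)) // lerD2r.
have ultra U : UltraFilter U -> \oo `<=` U -> u n - T (u n) @[n --> U] --> 0 ->
    exists2 v, fixed_points T v & forall y, dot (u n) y @[n --> U] --> dot v y.
  move=> UU Uoo uT; have UP : ProperFilter U by exact: ultra_proper.
  have UM := Uoo _ uM; have [v uv] := ultra_weak_cvg UU UM.
  by exists v => //; apply: demiclosed hT UM uv uT.
have uniq U U' v v' : UltraFilter U -> UltraFilter U' -> \oo `<=` U -> \oo `<=` U' ->
    fixed_points T v -> fixed_points T v' ->
    (forall y, dot (u n) y @[n --> U] --> dot v y) ->
    (forall y, dot (u n) y @[n --> U'] --> dot v' y) -> v = v'.
  move=> UU UU' Uoo Uoo' Tv Tv' uv uv'.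
  have UP : ProperFilter U by exact: ultra_proper.
  have UP' : ProperFilter U' by exact: ultra_proper.
  have [/cvg_ex[/= l hl] /cvg_ex[/= l' hl']] := (ucvg v Tv, ucvg v' Tv').
  (* By polarization <u n, v - v'> is determined by the two distances, so it has a limit [a] along
     the whole sequence; hence <v, v - v'> = a = <v', v - v'>. *)
  pose a := 2^-1 * (l' ^+ 2 - l ^+ 2 + `|v| ^+ 2 - `|v'| ^+ 2).
  have ha : dot (u n) (v - v') @[n --> \oo] --> a.
    have -> : (fun n => dot (u n) (v - v')) =
        fun n => 2^-1 * (`|u n - v'| ^+ 2 - `|u n - v| ^+ 2 + `|v| ^+ 2 - `|v'| ^+ 2).
      apply/funext => n; rewrite !(sqnormB hdot (u n)) dotC dotBl !(dotC _ (u n)).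
      by field.
    apply: cvgMl_tmp; apply: cvgB; last exact: cvg_cst.
    apply: cvgD; last exact: cvg_cst.
    by rewrite !expr2; apply: cvgB; under eq_cvg do rewrite expr2; apply: cvgM.
  have e : dot v (v - v') = a.
    apply: (cvg_unique (@Rhausdorff R) (uv _)); exact: cvg_trans (cvg_app _ Uoo) ha.
  have e' : dot v' (v - v') = a.
    apply: (cvg_unique (@Rhausdorff R) (uv' _)); exact: cvg_trans (cvg_app _ Uoo') ha.
  apply/eqP; rewrite -subr_eq0 -normr_eq0 -sqrf_eq0 hdot dotBl e e'.
  by rewrite subrr.
(* If no filter qualifies, the claim is vacuous and [p0] serves; otherwise the limit along an
   ultrafilter refining one such [F0] is the common limit. *)
have [[F0 [F0P F0oo F0T]]|none] := pselect (exists F0, [/\ ProperFilter F0, \oo `<=` F0 &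
    u n - T (u n) @[n --> F0] --> 0]); last first.
  by exists p0 => // F FP Foo FT; case: none; exists F.
have [U0 [U0U F0U0]] := ultraFilterLemma F0P.
have U0oo : \oo `<=` U0 := subset_trans F0oo F0U0.
have [v Tv uv] := ultra _ U0U U0oo (cvg_trans (cvg_app _ F0U0) F0T).
exists v => // F FP Foo FT y; apply: cvg_ultra => U UU FU.
have Uoo : \oo `<=` U := subset_trans Foo FU.
have [v' Tv' uv'] := ultra _ UU Uoo (cvg_trans (cvg_app _ FU) FT).
by rewrite (uniq _ _ _ _ U0U UU U0oo Uoo Tv Tv' uv uv').
Qed.
End WeakLimits.

(** * Supermartingales on words *)

(* Histories list the most recent letter first. *)
Definition history (U : Type) (a : nat -> U) (k : nat) : seq U := rev (mkseq a k).

Lemma historyS (U : Type) (a : nat -> U) k : history a k.+1 = a k :: history a k.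
Proof. by rewrite /history mkseqS rev_rcons. Qed.

Lemma size_history (U : Type) (a : nat -> U) k : size (history a k) = k.
Proof. by rewrite size_rev size_mkseq. Qed.

(** For a uniform next letter this is the usual conditional inequality, multiplied by the size of
    the alphabet. *)
Definition supermartingale (R : realType) (U : finType) (V : seq U -> R) : Prop :=
  forall s, \sum_b V (b :: s) <= #|U|%:R * V s.

(** * Ville's maximal inequality on words *)

Section Ville.
Context {d : measure_display} {Omega : measurableType d} {R : realType}.
Variables (P : probability Omega R) (U : finType) (X : nat -> Omega -> U).
Hypothesis hX : iid_uniform P X.

Lemma card_alphabet_gt0 : (0 < #|U|)%N.
Proof.
have [[w _]|] := pselect ([set: Omega] !=set0); first by apply/card_gt0P; exists (X 0%N w).
move/set0P/negP/negPn/eqP => e; have := @probability_setT _ _ _ P.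
by rewrite e measure0 => /eqP; rewrite eqe eq_sym oner_eq0.
Qed.

Lemma measurable_history k (B : set (seq U)) :
  measurable [set w | B (history (X ^~ w) k)].
Proof.
have [mX _ _] := hX.
elim: k B => [|k ih] B.
  have [Bn|Bn] := pselect (B [::]).
    by rewrite (_ : [set w | _] = setT) //; apply/seteqP; split.
  by rewrite (_ : [set w | _] = set0) //; apply/seteqP; split.
rewrite (_ : [set w | _] = \big[setU/set0]_(b : U)
   (X k @^-1` [set b] `&` [set w | B (b :: history (X ^~ w) k)])).
  by apply: bigsetU_measurable => b _; apply: measurableI => //; apply: (ih (fun s => B (b :: s))).
apply/seteqP; split => w; rewrite /= -bigcup_seq_cond historyS.
  by move=> Bw; exists (X k w) => //=; rewrite mem_index_enum.
by move=> [b _ /= [-> ]].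
Qed.

(** The event is a cylinder, one condition per letter. This is where uniformity and independence of
    the letters enter. *)
Lemma history_prob s : P [set w | history (X ^~ w) (size s) = s] = (#|U|%:R^-1 ^+ size s)%:E.
Proof.
have [_ PX iX] := hX.
have /card_gt0P[b0 _] := card_alphabet_gt0.
pose B k := [set nth b0 (rev s) k].
rewrite (_ : [set w | _] = \bigcap_(k in [set` iota 0 (size s)]) X k @^-1` B k).
  rewrite iX ?iota_uniq // (eq_bigr (fun=> (#|U|%:R^-1)%:E)) => [|k _]; last exact: PX.
  rewrite big_const_seq count_predT size_iota.
  by elim: (size s) => [|n ih] //=; rewrite ih exprS EFinM.
apply/seteqP; split => w /=.
  move=> hs k /=; rewrite mem_iota add0n /B /= => ks.
  by rewrite -hs /history revK nth_mkseq.
move=> hw; apply: (canLR revK); apply: (@eq_from_nth _ b0) => [|k].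
  by rewrite size_rev size_mkseq.
rewrite size_mkseq => ks; rewrite nth_mkseq //.
by apply: hw => /=; rewrite mem_iota.
Qed.

Lemma measure_bigsetU_le (I : Type) (r : seq I) (A : I -> set Omega) (x : I -> \bar R) :
  (forall k, measurable (A k)) -> (forall k, (P (A k) <= x k)%E) ->
  (P (\big[setU/set0]_(k <- r) A k) <= \sum_(k <- r) x k)%E.
Proof.
move=> mA Ax; suff [] : measurable (\big[setU/set0]_(k <- r) A k) /\
   (P (\big[setU/set0]_(k <- r) A k) <= \sum_(k <- r) x k)%E by [].
elim/big_ind2 : _ => [|B x1 C x2 [mB Bx] [mC Cx]|k _]; first by rewrite measure0.
  split; first exact: measurableU.
  exact: le_trans (measureU2 _ _ _) (leeD Bx Cx).
by split.
Qed.

Section MaximalInequality.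
Variable V : seq U -> R.
Hypotheses (V0 : forall s, 0 <= V s) (hV : supermartingale V).

(** Localizing to the words that extend [s] allows induction on the horizon: if [V s] already
    reaches [lam], the whole cylinder of [s] is charged; otherwise the cylinder splits by the next
    letter and the supermartingale inequality sums the bounds. *)
Lemma maximal_inequality_from (lam : R) n s : 0 < lam ->
  (P [set w | history (X ^~ w) (size s) = s /\
      exists2 k, (k <= n)%N & (lam <= V (history (X ^~ w) (size s + k)))%R] <=
   (lam^-1 * (V s * #|U|%:R^-1 ^+ size s))%:E)%E.
Proof.
move=> lam0.
pose A n s := [set w | history (X ^~ w) (size s) = s /\
  exists2 k, (k <= n)%N & (lam <= V (history (X ^~ w) (size s + k)))%R].
have mA n' s' : measurable (A n' s').
  rewrite (_ : A n' s' = [set w | history (X ^~ w) (size s') = s'] `&`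
    \bigcup_(k in [set k | (k <= n')%N])
      [set w | (lam <= V (history (X ^~ w) (size s' + k)))%R]); last first.
    by apply/seteqP; split => w [? [k ? ?]]; split => //; exists k.
  apply: measurableI; first exact: (measurable_history _ [set s']).
  by apply: bigcup_measurable => k _; exact: (measurable_history _ [set t | lam <= V t]).
have pos t : 0 <= lam^-1 * (V t * #|U|%:R^-1 ^+ size t).
  by rewrite mulr_ge0 ?mulr_ge0 ?invr_ge0 ?exprn_ge0 // ?invr_ge0 ltW.
rewrite -/(A n s); elim: n s => [|n ih] s.
all: have [Vs|Vs] := lerP lam (V s).
(* Goals 1 and 3 are the cases lam <= V s, for horizons 0 and n + 1. *)
1,3: rewrite (@le_trans _ _ (#|U|%:R^-1 ^+ size s)%:E) //;
  [ rewrite -history_prob le_measure ?inE //; [exact: (measurable_history _ [set s])|by move=> w []]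
  | by rewrite lee_fin mulrA ler_peMl ?exprn_ge0 ?invr_ge0 // mulrC ler_pdivlMr ?mul1r].
- rewrite (_ : A _ _ = set0) ?measure0 ?lee_fin //.
  apply/seteqP; split => // w [hw [k]]; rewrite leqn0 => /eqP ->.
  by rewrite addn0 hw leNgt Vs.
- have sub : A n.+1 s `<=` \big[setU/set0]_(b : U) A n (b :: s).
    move=> w [hw [[|k] kn]]; first by rewrite addn0 hw leNgt Vs.
    rewrite -bigcup_seq => lV; exists (X (size s) w); first by rewrite /= mem_index_enum.
    split; first by rewrite /= historyS hw.
    by exists k => //=; rewrite addSnnS.
  apply: le_trans (le_measure _ _ _ sub) _; rewrite ?inE //.
    exact: bigsetU_measurable.
  apply: le_trans (measure_bigsetU_le _ (fun b => mA n (b :: s)) (fun b => ih (b :: s))) _.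
  rewrite sumEFin lee_fin -mulr_sumr ler_pM2l ?invr_gt0 //= -mulr_suml exprS mulrA.
  rewrite ler_wpM2r ?exprn_ge0 ?invr_ge0 //.
  by rewrite ler_pdivrMr ?ltr0n ?card_alphabet_gt0 // mulrC hV.
Qed.

Lemma maximal_inequality (lam : R) : 0 < lam ->
  (P [set w | exists k, (lam <= V (history (X ^~ w) k))%R] <= (lam^-1 * V [::])%:E)%E.
Proof.
move=> lam0.
pose A n := [set w | exists2 k, (k <= n)%N & (lam <= V (history (X ^~ w) k))%R].
have mA n : measurable (A n).
  rewrite (_ : A n = \bigcup_(k in [set k | (k <= n)%N])
    [set w | (lam <= V (history (X ^~ w) k))%R]); last first.
    by apply/seteqP; split => w [k ? ?]; exists k.
  by apply: bigcup_measurable => k _; exact: (measurable_history _ [set t | lam <= V t]).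
rewrite (_ : mkset _ = \bigcup_n A n); last first.
  apply/seteqP; split => w /= => [[k hk]|[n _ [k _ hk]]]; last by exists k.
  by exists k => //; exists k.
have hA : P (A n) @[n --> \oo] --> P (\bigcup_n A n).
  apply: nondecreasing_cvg_mu => //; first exact: bigcup_measurable.
  move=> n n' nn'; apply/subsetPset => w [k kn hk]; exists k => //.
  exact: leq_trans kn nn'.
rewrite -(cvg_lim _ hA) //; apply: lime_le; first by apply/cvg_ex; eexists; exact: hA.
apply: nearW => n; have := @maximal_inequality_from lam n [::] lam0.
rewrite /= expr0 mulr1; congr (P _ <= _)%E; apply/seteqP; split => w /=.
  by move=> [_ [k kn]]; rewrite add0n => hk; exists k.
by move=> [k kn hk]; split => //; exists k.
Qed.

(** Unbounded paths lie in every event of reaching n + 1, and these have probability at most V [::]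
    / (n + 1). *)
Lemma ville_ae_bounded : \forall w \ae P, exists M, forall k, V (history (X ^~ w) k) <= M.
Proof.
pose A n := [set w | exists k, n.+1%:R <= V (history (X ^~ w) k)].
have mA n : measurable (A n).
  rewrite (_ : A n = \bigcup_k [set w | n.+1%:R <= V (history (X ^~ w) k)]); last first.
    by apply/seteqP; split => w [k]; exists k.
  by apply: bigcup_measurable => k _; exact: (measurable_history _ [set t | n.+1%:R <= V t]).
exists (\bigcap_n A n); split; first exact: bigcapT_measurable.
- apply/eqP; rewrite eq_le measure_ge0 andbT.
  have h : ((n.+1%:R^-1 * V [::])%:E : \bar R) @[n --> \oo] --> (0 * V [::])%:E.
    by apply: cvg_EFin; [exact: nearW|apply: cvgMr_tmp; exact: cvg_harmonic].
  rewrite mul0r in h.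
  rewrite -[leRHS](cvg_lim _ h) //; apply: lime_ge; first by apply/cvg_ex; eexists; exact: h.
  apply: nearW => n; apply: le_trans (maximal_inequality _) => //.
  by rewrite le_measure ?inE //; [exact: bigcapT_measurable|exact: mA|by move=> w; apply].
- move=> w /= nb n _; apply: contrapT => nA; apply: nb; exists n.+1%:R => k.
  by rewrite leNgt; apply/negP => hk; apply: nA; exists k; exact: ltW.
Qed.
End MaximalInequality.
End Ville.

Lemma ae_forall_countable d (T : measurableType d) (R : realType)
    (mu : {measure set T -> \bar R}) (I : countType) (Q : I -> T -> Prop) :
  (forall i, \forall x \ae mu, Q i x) -> \forall x \ae mu, forall i, Q i x.
Proof.
move=> hQ.
have : \forall x \ae mu, forall n, if unpickle n is Some i then Q i x else True.
  apply: ae_foralln => n; case: unpickle => [i|]; first exact: hQ.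
  exact: aeW.
by apply: filterS => x h i; have := h (pickle i); rewrite pickleK.
Qed.

(** Two different limits along ultrafilters would be separated by rationals a < b, and [f] would be
    infinitely often below [a] and infinitely often above [b]. *)
Lemma cvgn_no_upcrossing (R : realType) (f : nat -> R) (M : R) :
  (forall n, `|f n| <= M) ->
  (forall a b : rat, a < b ->
     (forall N, exists2 k, (N <= k)%N & f k <= ratr a) ->
     ~ forall N, exists2 k, (N <= k)%N & ratr b <= f k) ->
  cvgn f.
Proof.
move=> fM nocross.
have fcvg U : UltraFilter U -> exists l : R, f n @[n --> U] --> l.
  move=> UU; apply/cvg_ex; apply: (@ultra_bounded_cvg _ _ U f M) => //.
  by apply: nearW; have := ultra_proper (F := U).
have io U (A : set nat) : UltraFilter U -> \oo `<=` U -> U A ->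
    forall N, exists2 k, (N <= k)%N & A k.
  move=> UU Uoo UA N; have UP : ProperFilter U by exact: ultra_proper.
  have UN : U [set k | (N <= k)%N] by apply: Uoo; exact: nbhs_infty_ge.
  have /filter_ex[k [Ak Nk]] : U (A `&` [set k | (N <= k)%N]) by apply: filterI.
  by exists k.
have uniq U U' l l' : UltraFilter U -> UltraFilter U' -> \oo `<=` U -> \oo `<=` U' ->
    f n @[n --> U] --> l -> f n @[n --> U'] --> l' -> l' <= l.
  move=> UU UU' Uoo Uoo' fl fl'; rewrite leNgt; apply/negP => ll'.
  have UP : ProperFilter U by exact: ultra_proper.
  have UP' : ProperFilter U' by exact: ultra_proper.
  have [a] := rat_in_itvoo ll'; rewrite in_itv => /andP[la al'].
  have [b] := rat_in_itvoo al'; rewrite in_itv => /andP[ab bl'].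
  have ab' : a < b by rewrite -(ltr_rat R).
  apply: (nocross a b ab').
    by apply: (io _ _ UU) => //; exact: (cvgr_le _ fl).
  by apply: (io _ _ UU') => //; exact: (cvgr_ge _ fl').
have [U0 [U0U U0oo]] := @ultraFilterLemma _ \oo _.
have [l fl] := fcvg _ U0U.
apply/cvg_ex; exists l; apply: cvg_ultra => U UU Uoo.
have [l' fl'] := fcvg _ UU.
suff -> : l = l' by [].
by apply/eqP; rewrite eq_le (uniq _ _ _ _ _ _ _ _ fl fl') // (uniq _ _ _ _ _ _ _ _ fl' fl).
Qed.

(** * Upcrossings: [h] tells whether the asset is held, [K] is the capital *)

Section Upcrossing.
Variables (R : realType) (a b : R) (f K : nat -> R) (h : nat -> bool).
Hypothesis ab : a < b.
Hypothesis h0 : h 0 = (f 0 <= a).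
Hypothesis hS : forall k, h k.+1 = if h k then f k.+1 < b else f k.+1 <= a.
Hypothesis KS : forall k, K k.+1 = K k + (if h k then f k.+1 - f k else 0).

Lemma holding_lt n : h n -> f n < b.
Proof.
case: n => [|n]; first by rewrite h0 => /le_lt_trans; apply.
by rewrite hS; case: ifP => // _ /le_lt_trans; apply.
Qed.

Lemma not_holding_gt n : ~~ h n -> a < f n.
Proof.
case: n => [|n]; first by rewrite h0 ltNge.
by rewrite hS; case: ifP => _; rewrite -?ltNge -?leNgt //; apply: lt_le_trans.
Qed.

Lemma upcrossing_buy n : (exists2 k, (n <= k)%N & f k <= a) -> ~~ h n ->
  exists n', [/\ h n', f n' <= a & K n' = K n].
Proof.
move=> [k nk]; rewrite -(subnKC nk); move: (k - n)%N => l {k nk}.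
elim: l n => [|l ih] n fk nh.
  by have := not_holding_gt nh; rewrite ltNge -{1}(addn0 n) fk.
have KE : K n.+1 = K n by rewrite KS (negPf nh) addr0.
have [h1|h1] := boolP (h n.+1).
  by exists n.+1; split=> //; move: h1; rewrite hS (negPf nh).
by have [|n' [? ? ?]] := ih n.+1 _ h1; [rewrite addSnnS|exists n'; rewrite -KE].
Qed.

(** While the asset is held, capital minus price is constant, and the sale takes place at a price of
    at least [b]. The induction is on the waiting time. *)
Lemma upcrossing_sell n : (exists2 k, (n <= k)%N & b <= f k) -> h n ->
  exists2 n', ~~ h n' & K n + b - f n <= K n'.
Proof.
move=> [k nk]; rewrite -(subnKC nk); move: (k - n)%N => l {k nk}.
elim: l n => [|l ih] n fk hn.
  by have := holding_lt hn; rewrite ltNge -{1}(addn0 n) fk.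
have KE : K n.+1 = K n + (f n.+1 - f n) by rewrite KS hn.
have [h1|h1] := boolP (h n.+1).
  have [|n' ? le] := ih n.+1 _ h1; first by rewrite addSnnS.
  by exists n' => //; apply: le_trans le; rewrite KE; lra.
by exists n.+1 => //; move: h1; rewrite hS hn -leNgt KE; lra.
Qed.

(** Each round buys at or below [a] and sells at or above [b], so it gains at least b - a. *)
Lemma upcrossings_unbounded :
  (forall N, exists2 k, (N <= k)%N & f k <= a) ->
  (forall N, exists2 k, (N <= k)%N & b <= f k) -> forall M, exists k, M < K k.
Proof.
move=> fa fb M.
have [n0 nh0] : exists n, ~~ h n.
  have [h00|] := boolP (h 0); last by exists 0%N.
  by have [n] := upcrossing_sell (fb _) h00; exists n.
have gain N : exists2 n, ~~ h n & K n0 + N%:R * (b - a) <= K n.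
  elim: N => [|N [n nh Kn]]; first by exists n0 => //; rewrite mul0r addr0.
  have [n1 [h1 f1 K1]] := upcrossing_buy (fa n) nh.
  have [n2 h2 K2] := upcrossing_sell (fb n1) h1; exists n2 => //.
  by apply: le_trans K2; rewrite K1 -natr1 mulrDl mul1r; lra.
have ba : 0 < b - a by rewrite subr_gt0.
have [n _ Kn] := gain (Num.bound `|(M - K n0) / (b - a)|).
exists n; apply: lt_le_trans Kn; rewrite -ltrBlDl -ltr_pdivrMr //.
exact: le_lt_trans (ler_norm _) (archi_boundP (normr_ge0 _)).
Qed.
End Upcrossing.

(** * Almost sure convergence of nonnegative supermartingales *)

Section Convergence.
Context {d : measure_display} {Omega : measurableType d} {R : realType}.
Variables (P : probability Omega R) (U : finType) (X : nat -> Omega -> U).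
Hypothesis hX : iid_uniform P X.

Lemma sum_const_letter (v : R) : \sum_(u : U) v = #|U|%:R * v.
Proof. by rewrite sumr_const mulr_natl; congr (_ *+ _); apply: eq_card. Qed.

Section Trader.
Variables (V : seq U -> R) (a b : R).

(* A trader buys one unit of the asset with price [V] at or below [a] and sells it
   at or above [b]; starting with capital [a] keeps the capital nonnegative. *)
Fixpoint holding (s : seq U) : bool :=
  if s is _ :: s' then if holding s' then V s < b else V s <= a else V s <= a.

Fixpoint capital (s : seq U) : R :=
  if s is _ :: s' then capital s' + (if holding s' then V s - V s' else 0) else a.

Hypotheses (a0 : 0 <= a) (ab : a < b).
Hypotheses (V0 : forall s, 0 <= V s) (hV : supermartingale V).

(** Nonnegativity alone is not inductive: while the unit is held, the capital must cover its price,
    so that a fall of [V] cannot make it negative. *)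
Lemma capital_ge s : (if holding s then V s else a) <= capital s.
Proof.
elim: s => [|u s] /=; first by case: ifP.
case: (holding s) => /= ih.
  by case: ifP => [_|/negbT]; rewrite -?leNgt; move: ih ab; lra.
by case: ifP => [|_] /=; move: ih; lra.
Qed.

Lemma capital_ge0 s : 0 <= capital s.
Proof. by apply: le_trans (capital_ge s); case: ifP. Qed.

(** The position [holding s] is fixed before the next letter is drawn, so the expected gain is zero
    or that of [V]. *)
Lemma capital_supermartingale : supermartingale capital.
Proof.
move=> s /=; rewrite big_split /= sum_const_letter gerDl.
case: (holding s); last by rewrite big1.
rewrite big_split /= [X in _ + X]sum_const_letter mulrN subr_le0.
exact: hV.
Qed.

End Trader.

(** For each pair of rational levels the trader's capital is a nonnegative supermartingale, hence
    almost surely bounded, whereas infinitely many upcrossings would make it unbounded. *)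
Lemma supermartingale_ae_cvg (V : seq U -> R) :
  (forall s, 0 <= V s) -> supermartingale V ->
  \forall w \ae P, cvgn (fun k => V (history (X ^~ w) k)).
Proof.
move=> V0 hV.
have trade : \forall w \ae P, forall ab : rat * rat, 0 <= ab.1 -> ab.1 < ab.2 ->
    exists M, forall k, capital V (ratr ab.1) (ratr ab.2) (history (X ^~ w) k) <= M.
  apply: ae_forall_countable => -[a b] /=.
  have [a0|_] := boolP (0 <= a); last exact: aeW.
  have [ab|_] := boolP (a < b); last exact: aeW.
  have : \forall w \ae P, exists M, forall k,
      capital V (ratr a) (ratr b) (history (X ^~ w) k) <= M.
    apply: ville_ae_bounded => //.
      by apply: capital_ge0; rewrite ?ler0q ?ltr_rat.
    exact: capital_supermartingale.
  by apply: filterS.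
have := ville_ae_bounded hX V0 hV; apply: filterS2 trade => w trade [M VM].
apply: (@cvgn_no_upcrossing _ _ M) => [n|a b ab fa fb]; first by rewrite ger0_norm.
(* Since [V] is nonnegative, a level it falls below is nonnegative, so the trader is needed for such
   levels only. *)
have a0 : 0 <= a.
  have [k _ Vk] := fa 0%N; rewrite -(ler0q R); exact: le_trans (V0 _) Vk.
have [M' KM] := trade (a, b) a0 ab.
have [] := @upcrossings_unbounded R (ratr a) (ratr b) _
  (fun k => capital V (ratr a) (ratr b) (history (X ^~ w) k))
  (fun k => holding V (ratr a) (ratr b) (history (X ^~ w) k)) _ _ _ _ fa fb M'.
- by rewrite ltr_rat.
- by [].
- by move=> k; rewrite historyS.
- by move=> k; rewrite historyS.
- by move=> k; rewrite ltNge KM.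
Qed.

(** The word [s] itself is excluded, so that a new letter adds [g] of the old word, which is known
    before the draw. *)
Fixpoint past_sum (g : seq U -> R) (s : seq U) : R :=
  if s is _ :: s' then g s' + past_sum g s' else 0.

Lemma past_sum_history g (x : nat -> U) k :
  past_sum g (history x k) = \sum_(n < k) g (history x n).
Proof.
elim: k => [|k ih]; first by rewrite big_ord0.
by rewrite historyS /= ih big_ord_recr addrC.
Qed.

(** Adding the accumulated decrements to [V] still gives a nonnegative supermartingale, which is
    almost surely bounded. *)
Lemma supermartingale_ae_sum (V g : seq U -> R) :
  (forall s, 0 <= V s) -> (forall s, 0 <= g s) ->
  (forall s, \sum_u V (u :: s) <= #|U|%:R * (V s - g s)) ->
  \forall w \ae P, exists M, forall k, \sum_(n < k) g (history (X ^~ w) n) <= M.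
Proof.
move=> V0 g0 hVg.
have p0 s : 0 <= past_sum g s by elim: s => //= u s ih; rewrite addr_ge0.
pose W s := V s + past_sum g s.
have : \forall w \ae P, exists M, forall k, W (history (X ^~ w) k) <= M.
  apply: ville_ae_bounded => // s; first by rewrite addr_ge0.
  rewrite big_split /= [X in _ + X]sum_const_letter.
  by have := hVg s; rewrite !mulrDr mulrN; lra.
apply: filterS => w [M hM]; exists M => k; rewrite -past_sum_history.
by apply: le_trans (hM k); rewrite /W lerDr.
Qed.
End Convergence.

(** * The Lyapunov function *)

(** Reindexing by the lag l = k - n. The minimum reflects truncated subtraction: no lag reaches
    before time 0. *)
Lemma sum_lags (R : realType) (F : nat -> R) a k :
  \sum_(k - a <= n < k) F (k - n)%N = \sum_(1 <= l < (minn a k).+1) F l.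
Proof.
have gen b l : \sum_(b <= n < b + l) F (b + l - n)%N = \sum_(1 <= n < l.+1) F n.
  elim: l b => [|l ih] b; first by rewrite addn0 !big_geq.
  rewrite big_nat_recr //= -(ih b.+1) addrC big_ltn ?addnS ?ltnS ?leq_addr //.
  by rewrite subSn ?leq_addr // addKn addSn.
have [ak|ka] := leqP a k.
  by rewrite -{2 3}(subnK ak) gen.
by rewrite (eqP (ltnW ka)) -{2 3}(add0n k) gen.
Qed.

Lemma ler_sum_nat_widen (R : realType) (F : nat -> R) a b :
  (a <= b)%N -> (forall l, (0 < l)%N -> 0 <= F l) ->
  \sum_(1 <= l < a.+1) F l <= \sum_(1 <= l < b.+1) F l.
Proof.
move=> ab F0; rewrite (@big_cat_nat _ _ _ a.+1 1 b.+1) //= lerDl.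
rewrite big_nat; apply: sumr_ge0 => l /andP[al _]; apply: F0.
exact: leq_trans al.
Qed.

(** * Tail sums of the parameters and the step size *)

Section Tails.
Variables (R : realType) (eps : nat -> R).
Hypothesis eps_gt0 : forall l, (0 < l)%N -> 0 < eps l.
Hypothesis eps_sum : cvgn (fun n => \sum_(1 <= l < n) eps l).

Definition tail_sum (l : nat) : R :=
  limn (fun n => \sum_(1 <= k < n) eps k) - \sum_(1 <= k < l) eps k.

Lemma tail_sum1 : tail_sum 1 = limn (fun n => \sum_(1 <= k < n) eps k).
Proof. by rewrite /tail_sum big_geq // subr0. Qed.

Lemma tail_sumS l : (0 < l)%N -> tail_sum l.+1 = tail_sum l - eps l.
Proof. by move=> l0; rewrite /tail_sum big_nat_recr //= opprD addrA. Qed.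

Lemma tail_sum_ge0 l : 0 <= tail_sum l.
Proof.
rewrite subr_ge0.
apply: (@nondecreasing_cvgn_le _ (fun n => \sum_(1 <= k < n) eps k)) => //.
apply/nondecreasing_seqP => -[|n]; first by rewrite !big_geq.
by rewrite [leRHS]big_nat_recr //= lerDl; case: n => [|n]; rewrite ?ltW ?eps_gt0.
Qed.

Lemma tail_sum_cvg : tail_sum l @[l --> \oo] --> 0.
Proof.
rewrite -(subrr (limn (fun n => \sum_(1 <= k < n) eps k))).
by apply: cvgB => //; exact: cvg_cst.
Qed.

Lemma inv_step_h_gt0 m j :
  0 < 1 + m%:R^-1 * tail_sum 1 + \sum_(1 <= l < j.+1) (eps l)^-1.
Proof.
rewrite ltr_wpDr //; last by rewrite ltr_wpDr // mulr_ge0 ?tail_sum_ge0 ?invr_ge0.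
rewrite big_nat; apply: sumr_ge0 => l /andP[l0 _].
by rewrite invr_ge0 ltW // eps_gt0.
Qed.

Lemma step_h_gt0 m j : 0 < step_h m eps j.
Proof. by rewrite /step_h -tail_sum1 invr_gt0 inv_step_h_gt0. Qed.

Lemma step_h_mul m j : step_h m eps j *
  (1 + m%:R^-1 * tail_sum 1 + \sum_(1 <= l < j.+1) (eps l)^-1) = 1.
Proof. by rewrite /step_h -tail_sum1 mulVf // gt_eqF // inv_step_h_gt0. Qed.

Lemma step_h_le1 m j : step_h m eps j <= 1.
Proof.
rewrite /step_h -tail_sum1 invf_le1 ?inv_step_h_gt0 // -addrA lerDl.
rewrite addr_ge0 ?mulr_ge0 ?tail_sum_ge0 ?invr_ge0 //.
rewrite big_nat; apply: sumr_ge0 => l /andP[l0 _].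
by rewrite invr_ge0 ltW // eps_gt0.
Qed.

Lemma step_h_anti m j j' : (j <= j')%N -> step_h m eps j' <= step_h m eps j.
Proof.
move=> jj'; rewrite /step_h -tail_sum1 lef_pV2 ?posrE ?inv_step_h_gt0 // lerD2l.
by apply: ler_sum_nat_widen => // l l0; rewrite invr_ge0 ltW // eps_gt0.
Qed.

End Tails.

Definition step_size (R : realType) m (j : nat -> 'I_m -> nat) (eps : nat -> R)
  (c : R) (k : nat) : R := c * step_h m eps (cur_delay j k).

(** * One-step descent of the Lyapunov function *)

Section Descent.
Variables (R : realType) (H : completeNormedModType R).
Variable dot : {dot H for idfun}.
Hypothesis hdot : induces_norm dot.
Variables (m : nat) (E : 'I_m -> set H).
Hypothesis hE : orthogonal_decomposition dot E.
Variables (T : H -> H) (j : nat -> 'I_m -> nat) (eps : nat -> R) (c : R).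
Hypothesis hT : nonexpansive T.
Hypothesis eps_gt0 : forall l : nat, (0 < l)%N -> 0 < eps l.
Hypothesis eps_sum : cvgn (fun n => \sum_(1 <= l < n) eps l).
Hypothesis c0 : 0 < c.

Local Notation eta := (step_size j eps c).

Definition residual (u : nat -> H) (k : nat) : H :=
  delayed E u k (j k) - T (delayed E u k (j k)).

Definition lyapunov (p : H) (u : nat -> H) (k : nat) : R :=
  `|u k - p| ^+ 2 + m%:R^-1 *
    \sum_(n < k) tail_sum eps (k - n) * `|u n.+1 - u n| ^+ 2.

Lemma lyapunov_ge0 p u k : 0 <= lyapunov p u k.
Proof.
rewrite addr_ge0 ?mulr_ge0 ?exprn_ge0 ?invr_ge0 //.
by apply: sumr_ge0 => n _; rewrite mulr_ge0 ?exprn_ge0 ?tail_sum_ge0.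
Qed.

(** Block [b] of the delay error telescopes into its last [j k b] increments, and Young's inequality
    with weight [eps (k - n)] is applied to each. Working block by block, the squared blocks add up
    to full squared norms without a factor [m]. *)
Lemma delay_error (u : nat -> H) k (s : H) (e : R) :
  - (2 * e * dot (u k - delayed E u k (j k)) s) <=
  \sum_(n < k) eps (k - n) * `|u n.+1 - u n| ^+ 2 +
  e ^+ 2 * (\sum_(1 <= l < (cur_delay j k).+1) (eps l)^-1) * `|s| ^+ 2.
Proof.
set J := cur_delay j k; set L := \sum_(1 <= l < J.+1) _.
pose D n b := block E (u n.+1 - u n) b.
have blockE b : block E (u k - delayed E u k (j k)) b = \sum_(k - j k b <= n < k) D n b.
  rewrite (blockB hdot hE) (block_delayed hdot hE) -(blockB hdot hE).
  by rewrite -(telescope_sumr u (leq_subr _ _)) (block_sum hdot hE).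
rewrite (dot_block hdot hE) mulr_sumr -sumrN.
have -> : \sum_(n < k) eps (k - n) * `|u n.+1 - u n| ^+ 2 =
    \sum_b \sum_(n < k) eps (k - n) * `|D n b| ^+ 2.
  rewrite exchange_big /=; apply: eq_bigr => n _.
  by rewrite (sqnorm_block hdot hE) mulr_sumr.
rewrite (sqnorm_block hdot hE s) mulr_sumr -big_split /=.
apply: ler_sum => b _; set sb := block E s b.
have jb : (j k b <= J)%N by rewrite /J /cur_delay (leq_bigmax b).
have young n : (n < k)%N ->
    - (2 * e * dot (D n b) sb) <=
      eps (k - n) * `|D n b| ^+ 2 + (eps (k - n))^-1 * (e ^+ 2 * `|sb| ^+ 2).
  move=> nk; have e0 : 0 < eps (k - n) by rewrite eps_gt0 // subn_gt0.
  have := dot_young hdot (D n b) (- e *: sb) e0.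
  by rewrite dotZr sqnormZ sqrrN; lra.
rewrite blockE dotC linear_sumr /= mulr_sumr -sumrN.
apply: (@le_trans _ _ (\sum_(k - j k b <= n < k)
    (eps (k - n) * `|D n b| ^+ 2 + (eps (k - n))^-1 * (e ^+ 2 * `|sb| ^+ 2)))).
  rewrite [leLHS]big_nat [leRHS]big_nat; apply: ler_sum => n /andP[_ nk].
  by rewrite dotC young.
rewrite big_split /=; apply: lerD.
  rewrite -(big_mkord xpredT (fun n => eps (k - n) * `|D n b| ^+ 2)).
  rewrite [leRHS](@big_cat_nat _ _ _ (k - j k b)) ?leq_subr //= lerDr.
  rewrite big_nat; apply: sumr_ge0 => n /andP[_ nk].
  rewrite mulr_ge0 ?exprn_ge0 // ltW // eps_gt0 // subn_gt0.
  exact: leq_trans nk (leq_subr _ _).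
(* The inverse weights run over the lags of this block, at most [J]; enlarging to all lags up to [J]
   gives a factor common to all blocks. *)
rewrite -mulr_suml (sum_lags (fun l => (eps l)^-1)) [leRHS]mulrAC [leRHS]mulrC.
rewrite ler_wpM2r ?(mulr_ge0 (sqr_ge0 _) (sqr_ge0 _)) //.
apply: ler_sum_nat_widen => [|l l0]; last by rewrite invr_ge0 ltW // eps_gt0.
by rewrite (leq_trans (geq_minl _ _)).
Qed.

Definition extend (u : nat -> H) (k : nat) (y : H) : nat -> H :=
  fun n => if (n <= k)%N then u n else y.

Definition update (u : nat -> H) (k : nat) (b : 'I_m) : H :=
  u k - eta k *: block E (residual u k) b.

(** As time advances, each old increment loses the weight [eps (k - n)]; these released amounts pay
    for the delay error. *)
Lemma lyapunov_extend p u k y : lyapunov p (extend u k y) k.+1 =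
  `|y - p| ^+ 2 + m%:R^-1 * (tail_sum eps 1 * `|y - u k| ^+ 2 +
    \sum_(n < k) (tail_sum eps (k - n) - eps (k - n)) * `|u n.+1 - u n| ^+ 2).
Proof.
rewrite /lyapunov /extend ltnn big_ord_recr /= leqnn ltnn subSnn.
congr (_ + _ * _); rewrite addrC; congr (_ + _); apply: eq_bigr => n _.
by rewrite ltn_ord ltnW ?ltn_ord // subSn ?tail_sumS ?subn_gt0 // ltnW.
Qed.

Lemma lyapunov_descent p u k : (0 < m)%N -> T p = p ->
  \sum_b lyapunov p (extend u k (update u k b)) k.+1 <=
  m%:R * (lyapunov p u k - m%:R^-1 * ((1 - c) * eta k) * `|residual u k| ^+ 2).
Proof.
move=> m0 Tp; set s := residual u k; set e := eta k.
have mne0 : m%:R != 0 :> R by rewrite pnatr_eq0 -lt0n.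
pose G := \sum_(n < k) eps (k - n) * `|u n.+1 - u n| ^+ 2.
pose D := \sum_(n < k) tail_sum eps (k - n) * `|u n.+1 - u n| ^+ 2.
pose L := \sum_(1 <= l < (cur_delay j k).+1) (eps l)^-1.
have lyapE b : lyapunov p (extend u k (update u k b)) k.+1 =
    `|u k - p| ^+ 2 + m%:R^-1 * (D - G) - 2 * e * dot (u k - p) (block E s b) +
    (e ^+ 2 + m%:R^-1 * tail_sum eps 1 * e ^+ 2) * `|block E s b| ^+ 2.
  rewrite lyapunov_extend.
  under eq_bigr do rewrite mulrBl; rewrite sumrB -/D -/G.
  rewrite /update -/s -/e addrAC (sqnormB hdot (u k - p)) dotZr sqnormZ.
  rewrite [u k - _ - u k]addrAC subrr sub0r normrN sqnormZ.
  by ring.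
under eq_bigr do rewrite lyapE.
rewrite big_split sumrB /= -!mulr_sumr -(sqnorm_block hdot hE).
have -> : \sum_b dot (u k - p) (block E s b) = dot (u k - p) s.
  by rewrite -[s in RHS](sum_block hdot hE) linear_sumr.
rewrite sumr_const card_ord -(mulr_natl (_ + _) m).
have h1 := delay_error u k s e; rewrite -/G -/L in h1.
have h2 := firmly_nonexpansive_residual hdot (delayed E u k (j k)) hT Tp.
rewrite -/(residual u k) -/s in h2.
have e0 : 0 < e by rewrite /e mulr_gt0 // step_h_gt0.
(* The three terms are the costs in e^2 |s|^2 of the step itself, of the new memory term and of the
   delay. The step size makes their total e c |s|^2, against the gain e |s|^2 from cocoercivity. *)
have h3 : e * (1 + m%:R^-1 * tail_sum eps 1 + L) = c.
  by rewrite /e /step_size -mulrA step_h_mul // mulr1.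
have h4 : dot (u k - p) s = dot (u k - delayed E u k (j k)) s + dot (delayed E u k (j k) - p) s.
  by rewrite !dotBl; ring.
have h5 : e ^+ 2 * (1 + m%:R^-1 * tail_sum eps 1 + L) * `|s| ^+ 2 = e * c * `|s| ^+ 2.
  by rewrite -h3; ring.
have h6 : e * `|s| ^+ 2 <= e * (2 * dot (delayed E u k (j k) - p) s).
  by rewrite ler_pM2l.
rewrite /lyapunov -/D -/s -/e.
have -> : m%:R * (`|u k - p| ^+ 2 + m%:R^-1 * D - m%:R^-1 * ((1 - c) * e) * `|s| ^+ 2) =
   m%:R * `|u k - p| ^+ 2 + D - (1 - c) * e * `|s| ^+ 2 by field.
have -> : m%:R * (`|u k - p| ^+ 2 + m%:R^-1 * (D - G)) = m%:R * `|u k - p| ^+ 2 + D - G by field.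
rewrite h4; move: h1 h5 h6; set q := m%:R^-1; lra.
Qed.

End Descent.

(** * Almost sure convergence *)

Lemma summable_cvgn (R : realType) (a : nat -> R) (M : R) :
  (forall n, 0 <= a n) -> (forall k, \sum_(n < k) a n <= M) ->
  cvgn (fun k => \sum_(n < k) a n).
Proof.
move=> a0 aM; apply: nondecreasing_is_cvgn; last by exists M => _ [k _ <-].
by apply/nondecreasing_seqP => n; rewrite big_ord_recr /= lerDl.
Qed.

Lemma summable_cvg0 (R : realType) (a : nat -> R) (M : R) :
  (forall n, 0 <= a n) -> (forall k, \sum_(n < k) a n <= M) ->
  a n @[n --> \oo] --> 0.
Proof.
move=> a0 aM; apply: cvg_series_cvg_0.
rewrite (_ : series a = fun k => \sum_(n < k) a n); first exact: summable_cvgn a0 aM.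
by apply/funext => k; rewrite /series /= big_mkord.
Qed.

(** Split the sum at a fixed [N]: later terms carry little of the mass of [a] and [t] is bounded,
    while earlier terms have lags so long that [t] is small. *)
Lemma convolution_cvg0 (R : realType) (t a : nat -> R) (M : R) :
  (forall n, 0 <= a n) -> (forall k, \sum_(n < k) a n <= M) ->
  (forall n, 0 <= t n) -> t n @[n --> \oo] --> 0 ->
  \sum_(n < k) t (k - n)%N * a n @[k --> \oo] --> 0.
Proof.
move=> a0 aM t0 tcvg.
have M0 : 0 <= M by have := aM 0%N; rewrite big_ord0.
have [C C0 tC] : exists2 C : R, 0 < C & forall n, t n <= C.
  have /cvg_seq_bounded[C [_ hC]] : cvgn t by apply/cvg_ex; exists 0.
  exists (`|C| + 1) => [|n]; first by rewrite ltr_wpDl.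
  apply: le_trans (ler_norm _) (hC _ _ n I).
  by rewrite (le_lt_trans (ler_norm C)) // ltrDl.
have acvg := summable_cvgn a0 aM.
set l := limn (fun k => \sum_(n < k) a n) in acvg *.
have sl k : \sum_(n < k) a n <= l.
  apply: (@nondecreasing_cvgn_le _ (fun k => \sum_(n < k) a n)) acvg k.
  by apply/nondecreasing_seqP => n; rewrite big_ord_recr /= lerDl.
apply/cvgr0Pnorm_lt => e e0.
have e1 : 0 < e / (2 * C) by rewrite divr_gt0 // mulr_gt0.
have e2 : 0 < e / (2 * (M + 1)) by rewrite divr_gt0 // mulr_gt0 // ltr_wpDl.
have /cvgrPdist_lt/(_ _ e1)[N _ hN] := acvg.
have /cvgr0Pnorm_lt/(_ _ e2)[L _ hL] := tcvg.
exists (N + L)%N => // k /= NLk.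
have Nk : (N <= k)%N by rewrite (leq_trans _ NLk) // leq_addr.
rewrite ger0_norm; last by apply: sumr_ge0 => n _; rewrite mulr_ge0.
rewrite -(big_mkord xpredT (fun n => t (k - n)%N * a n)).
rewrite (@big_cat_nat _ _ _ N) //= big_mkord.
have early : \sum_(n < N) t (k - n)%N * a n <= e / (2 * (M + 1)) * M.
  apply: (@le_trans _ _ (\sum_(n < N) e / (2 * (M + 1)) * a n)).
    apply: ler_sum => n _; rewrite ler_wpM2r //.
    apply: le_trans (ler_norm _) (ltW (hL _ _)) => /=.
    have nN := ltnW (ltn_ord n).
    by rewrite leq_subRL ?(leq_trans nN) // (leq_trans _ NLk) // leq_add2r.
  by rewrite -mulr_sumr ler_wpM2l // ltW.
have late : \sum_(N <= n < k) t (k - n)%N * a n <= C * (l - \sum_(n < N) a n).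
  apply: (@le_trans _ _ (C * \sum_(N <= n < k) a n)).
    by rewrite mulr_sumr; apply: ler_sum => n _; rewrite ler_wpM2r.
  rewrite ler_wpM2l ?(ltW C0) // lerBrDr; apply: le_trans (sl k).
  by rewrite -!(big_mkord xpredT a) addrC -(@big_cat_nat _ _ _ N).
have lN : l - \sum_(n < N) a n < e / (2 * C).
  exact: le_lt_trans (ler_norm _) (hN N (leqnn N)).
have h1 : C * (l - \sum_(n < N) a n) < e / 2.
  rewrite (_ : e / 2 = C * (e / (2 * C))) ?ltr_pM2l //.
  by field; rewrite gt_eqF.
have h2 : e / (2 * (M + 1)) * M <= e / 2.
  rewrite (_ : e / 2 = e / (2 * (M + 1)) * (M + 1)); last by field; rewrite gt_eqF // ltr_wpDl.
  by rewrite ler_pM2l // lerDl.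
by lra.
Qed.

Lemma cvg_norm_sqrt (R : realType) (H : completeNormedModType R)
    (F : set_system nat) (f : nat -> H) (l : R) : Filter F ->
  `|f n| ^+ 2 @[n --> F] --> l -> `|f n| @[n --> F] --> Num.sqrt l.
Proof.
move=> FF /(continuous_cvg _ (@sqrt_continuous R _)).
by apply: cvg_trans; apply: near_eq_cvg; apply: nearW => n; rewrite /= sqrtr_sqr normr_id.
Qed.

Lemma dist_lag_le (R : realType) (H : completeNormedModType R) (u : nat -> H) k a :
  `|u k - u (k - a)%N| <= \sum_(l < a) `|u (k - l.+1).+1 - u (k - l.+1)%N|.
Proof.
elim: a => [|a ih]; first by rewrite subn0 subrr normr0 big_ord0.
rewrite big_ord_recr /= -(subrKA (u (k - a)%N)) (le_trans (ler_normD _ _)) //.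
apply: lerD => //.
have [ak|ka] := ltnP a k; first by rewrite -subSn ?subSS.
by rewrite (eqP ka) (eqP (leqW ka)) subrr normr0 normr_ge0.
Qed.

(** The distances to [p] stay within |p - q| of a convergent sequence, so they form a Cauchy
    sequence. *)
Lemma cvgn_dist_dense (R : realType) (H : completeNormedModType R) (u : nat -> H) (p : H) :
  (forall e : R, 0 < e -> exists2 q : H, `|p - q| < e & cvgn (fun n => `|u n - q|)) ->
  cvgn (fun n => `|u n - p|).
Proof.
move=> hq; apply: (@cauchy_cvg R^o); apply: cauchy_exP => e e0.
have e2 : 0 < e / 2 by rewrite divr_gt0.
have [q pq /cvg_ex[/= l /cvgrPdist_lt/(_ _ e2) hl]] := hq _ e2.
exists l; rewrite -ball_normE /=; apply: filterS hl => n /= hn.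
have h := ler_dist_dist (u n - q) (u n - p).
have hpq : u n - q - (u n - p) = p - q by rewrite opprB addrC subrKA.
rewrite hpq in h.
rewrite -(subrKA `|u n - q|) (le_lt_trans (ler_normD _ _)) //.
by rewrite (splitr e) ltrD // (le_lt_trans h).
Qed.

(** The dense set need not meet [A], so for each code of a center in [D] and each radius 1/(n.2 + 1)
    a point of [A] in that ball is chosen, or [p0] if there is none. *)
Lemma countable_approx (R : realType) (H : completeNormedModType R) (A : set H) :
  separable H -> A !=set0 -> exists q : nat * nat -> H, (forall n, A (q n)) /\
    forall p, A p -> forall e : R, 0 < e -> exists n, `|p - q n| < e.
Proof.
move=> [D /countable_injP[f finj] dD] [p0 Ap0].
pose near_pt n := [set p | A p /\ exists d, [/\ D d, f d = n.1 & `|d - p| < n.2.+1%:R^-1]].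
exists (fun n => xget p0 (near_pt n)); split.
  by move=> n; case: xgetP => [p _ []|].
move=> p Ap e e0.
have e2 : 0 < e / 2 by rewrite divr_gt0.
have [k _ /(_ k (leqnn k)) hk] := near_infty_natSinv_lt (PosNum e2).
rewrite /= in hk.
have [|d [pd Dd]] := dD (ball p k.+1%:R^-1) _ (ball_open _ _).
  by exists p; apply: ballxx.
rewrite -ball_normE /= in pd.
exists (f d, k); case: xgetP => [q _ [Aq [d' [Dd' fd' dq]]]|/(_ p)[]]; last first.
  by split=> //; exists d; split; rewrite // distrC.
have dd' : d' = d by apply: finj; rewrite ?inE.
rewrite dd' /= in dq; rewrite -(subrKA d) (le_lt_trans (ler_normD _ _)) //.
rewrite (splitr e) ltrD //; first exact: lt_trans pd hk.
exact: lt_trans dq hk.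
Qed.

(** Delays are integers: if all of them exceeded [J] from [N] on, the liminf would be at least J +
    1. *)
Lemma frequently_le_liminf (R : realType) m (j : nat -> 'I_m -> nat) (J : nat) :
  (liminf_delay R j <= J%:R%:E)%E ->
  forall N, exists2 k, (N <= k)%N & (cur_delay j k <= J)%N.
Proof.
move=> hJ N; apply: contrapT => nN.
have : (J.+1%:R%:E <= liminf_delay R j)%E.
  rewrite /liminf_delay limn_einf_lim (cvg_lim _ (@cvg_einfs_sup _ _)) //.
  apply: (@le_trans _ _ (einfs (fun k => (cur_delay j k)%:R%:E : \bar R) N)).
    apply: le_ereal_inf_tmp => _ [k /= Nk <-]; rewrite lee_fin ler_nat ltnNge.
    by apply/negP => jk; apply: nN; exists k.
  by apply: ereal_sup_ubound; exists N.
by move/le_trans/(_ hJ); rewrite lee_fin ler_nat ltnn.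
Qed.

(** * Iterates as functions of words, and their pathwise limits *)

Section Trajectories.
Variables (R : realType) (H : completeNormedModType R).
Variable dot : {dot H for idfun}.
Hypothesis hdot : induces_norm dot.
Variables (m : nat) (E : 'I_m -> set H).
Hypothesis hE : orthogonal_decomposition dot E.
Variables (T : H -> H) (j : nat -> 'I_m -> nat) (eps : nat -> R) (c : R).

Lemma arock_update (x0 : H) (a : nat -> 'I_m) (u : nat -> H) :
  arock E (fun y => y - T y) x0 (step_size j eps c) a j u ->
  u 0%N = x0 /\ forall k, u k.+1 = update E T j eps c u k (a k).
Proof.
move=> [u0 uS]; split=> // k.
rewrite -(sum_block hdot hE (u k.+1)) (bigD1 (a k)) //= uS eqxx.
rewrite (eq_bigr (block E (u k))) => [|b /negPf nb]; last by rewrite uS nb.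
rewrite addrAC; congr (_ - _); rewrite -[RHS](sum_block hdot hE).
by rewrite [RHS](bigD1 (a k)).
Qed.

Lemma residual_ext (u v : nat -> H) k :
  (forall n, (n <= k)%N -> u n = v n) -> residual E T j u k = residual E T j v k.
Proof.
move=> uv; have e : delayed E u k (j k) = delayed E v k (j k).
  by apply: eq_bigr => b _; rewrite uv // leq_subr.
by rewrite /residual e.
Qed.

Lemma update_ext (u v : nat -> H) k b :
  (forall n, (n <= k)%N -> u n = v n) ->
  update E T j eps c u k b = update E T j eps c v k b.
Proof. by move=> uv; rewrite /update uv // (residual_ext uv). Qed.

Lemma lyapunov_ext p (u v : nat -> H) k :
  (forall n, (n <= k)%N -> u n = v n) ->
  lyapunov m eps p u k = lyapunov m eps p v k.
Proof.
move=> uv; rewrite /lyapunov uv //; congr (_ + _ * _).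
by apply: eq_bigr => n _; rewrite !uv // ltnW.
Qed.

(** The value is a whole path, since the next update reads delayed iterates. *)
Fixpoint trajectory (x0 : H) (s : seq 'I_m) : nat -> H :=
  if s is b :: s' then
    extend (trajectory x0 s') (size s') (update E T j eps c (trajectory x0 s') (size s') b)
  else fun=> x0.

Lemma trajectory_history (a : nat -> 'I_m) (u : nat -> H) :
  (forall k, u k.+1 = update E T j eps c u k (a k)) ->
  forall k n, (n <= k)%N -> trajectory (u 0%N) (history a k) n = u n.
Proof.
move=> uS; elim=> [|k ih] n; first by rewrite leqn0 => /eqP ->.
rewrite historyS /= /extend size_history leq_eqVlt => /orP[/eqP -> |nk].
  by rewrite ltnn uS; apply: update_ext.
by rewrite -ltnS nk ih.
Qed.

Section Pathwise.
Hypothesis hT : nonexpansive T.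
Hypothesis eps_gt0 : forall l : nat, (0 < l)%N -> 0 < eps l.
Hypothesis eps_sum : cvgn (fun n => \sum_(1 <= l < n) eps l).
Hypotheses (c0 : 0 < c) (c1 : c < 1).

Let g (u : nat -> H) k := step_size j eps c k * `|residual E T j u k| ^+ 2.

Lemma step_size_gt0 k : 0 < step_size j eps c k.
Proof. by rewrite mulr_gt0 // step_h_gt0. Qed.

Let g_ge0 u k : 0 <= g u k.
Proof. by rewrite mulr_ge0 ?exprn_ge0 // ltW // step_size_gt0. Qed.

(** The step size is at most 1, so its square is at most itself, and a block is no longer than the
    vector. *)
Lemma sqnorm_update_le (u : nat -> H) k b :
  `|update E T j eps c u k b - u k| ^+ 2 <= g u k.
Proof.
rewrite /update addrAC subrr sub0r normrN sqnormZ /g expr2 -mulrA.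
rewrite ler_wpM2l ?(ltW (step_size_gt0 _)) //.
apply: (@le_trans _ _ (`|block E (residual E T j u k) b| ^+ 2)).
  rewrite ler_piMl ?exprn_ge0 // /step_size -[leRHS]mulr1 ler_pM ?(ltW c0) ?(ltW c1) //.
    by rewrite ltW // step_h_gt0.
  exact: step_h_le1.
by rewrite ler_pXn2r ?nnegrE // (norm_block_le hdot hE).
Qed.

Section Path.
Variables (a : nat -> 'I_m) (u : nat -> H) (M : R).
Hypothesis uS : forall k, u k.+1 = update E T j eps c u k (a k).
Hypothesis gM : forall k, \sum_(n < k) g u n <= M.

Lemma sum_sqnorm_increment_le k : \sum_(n < k) `|u n.+1 - u n| ^+ 2 <= M.
Proof.
by apply: le_trans (gM k); apply: ler_sum => n _; rewrite uS sqnorm_update_le.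
Qed.

Lemma increment_cvg0 : `|u n.+1 - u n| @[n --> \oo] --> 0.
Proof.
have : `|u n.+1 - u n| ^+ 2 @[n --> \oo] --> 0.
  apply: (@summable_cvg0 _ (fun n => `|u n.+1 - u n| ^+ 2) M) => [n|].
    by rewrite exprn_ge0.
  exact: sum_sqnorm_increment_le.
by move/cvg_norm_sqrt; rewrite sqrtr0.
Qed.

(** The memory term vanishes, being a convolution of the tail sums, which tend to 0, with the
    summable squared increments. *)
Lemma lyapunov_cvg_dist p :
  cvgn (lyapunov m eps p u) -> cvgn (fun n => `|u n - p|).
Proof.
move=> /cvg_ex[/= l hl].
have h : \sum_(n < k) tail_sum eps (k - n) * `|u n.+1 - u n| ^+ 2 @[k --> \oo] --> 0.
  apply: (@convolution_cvg0 _ (tail_sum eps) (fun n => `|u n.+1 - u n| ^+ 2) M).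
  - by move=> n; rewrite exprn_ge0.
  - exact: sum_sqnorm_increment_le.
  - by move=> n; apply: tail_sum_ge0.
  - exact: tail_sum_cvg.
have h1 : `|u n - p| ^+ 2 @[n --> \oo] --> l - m%:R^-1 * 0.
  have -> : (fun n => `|u n - p| ^+ 2) = fun k => lyapunov m eps p u k -
      m%:R^-1 * \sum_(n < k) tail_sum eps (k - n) * `|u n.+1 - u n| ^+ 2.
    by apply/funext => k; rewrite /lyapunov addrK.
  by apply: cvgB => //; apply: cvgMl_tmp.
by apply/cvg_ex; exists (Num.sqrt (l - m%:R^-1 * 0)); exact: cvg_norm_sqrt.
Qed.

(** With delays at most [J], the error is bounded by a fixed number of recent increments, each
    tending to 0. *)
Lemma delay_error_cvg0 (F : set_system nat) J : Filter F -> \oo `<=` F ->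
  F [set k | (cur_delay j k <= J)%N] ->
  `|u k - delayed E u k (j k)| @[k --> F] --> 0.
Proof.
move=> FF Foo FJ.
have hS : \sum_(b < m) \sum_(l < J) `|u (k - l.+1).+1 - u (k - l.+1)%N| @[k --> F] -->
    \sum_(b < m) \sum_(l < J) (0 : R).
  apply: cvg_big => [|b _]; first exact: add_continuous.
  apply: cvg_big => [|l _]; first exact: add_continuous.
  have hl : (k - l.+1)%N @[k --> \oo] --> \oo.
    by apply: cvg_subnr.
  by have := cvg_comp _ _ hl increment_cvg0; apply: cvg_trans; apply: cvg_app.
rewrite big1 in hS; last by move=> b _; rewrite big1.
apply: (squeeze_cvgr _ (cvg_cst 0) hS); apply: filterS FJ => k /= jJ.
rewrite normr_ge0 /= -{1}(sum_block hdot hE (u k)) /delayed -sumrB.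
rewrite (le_trans (ler_norm_sum _ _ _)) //; apply: ler_sum => b _.
rewrite -(blockB hdot hE) (le_trans (norm_block_le hdot hE _ _)) //.
apply: le_trans (dist_lag_le _ _ _) _.
have jb : (j k b <= J)%N by apply: leq_trans jJ; rewrite /cur_delay (leq_bigmax b).
rewrite -(big_mkord xpredT (fun l => `|u (k - l.+1).+1 - u (k - l.+1)%N|)).
rewrite -(big_mkord xpredT (fun l => `|u (k - l.+1).+1 - u (k - l.+1)%N|)).
by rewrite [leRHS](@big_cat_nat _ _ _ (j k b)) //= lerDl sumr_ge0.
Qed.

(** Where the delay is at most [J] the step size is at least c h_J, so the summable terms [g u k]
    control the squared residual. *)
Lemma residual_cvg0 (F : set_system nat) J : Filter F -> \oo `<=` F ->
  F [set k | (cur_delay j k <= J)%N] -> `|residual E T j u k| @[k --> F] --> 0.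
Proof.
move=> FF Foo FJ.
have hJ : 0 < c * step_h m eps J by rewrite mulr_gt0 // step_h_gt0.
have h : (c * step_h m eps J)^-1 * g u k @[k --> F] --> (c * step_h m eps J)^-1 * 0.
  apply: cvgMl_tmp; apply: cvg_trans (cvg_app _ Foo) _.
  exact: (@summable_cvg0 _ (g u) M).
rewrite mulr0 in h.
have h2 : `|residual E T j u k| ^+ 2 @[k --> F] --> 0.
  apply: (squeeze_cvgr _ (cvg_cst 0) h); apply: filterS FJ => k /= jJ.
  rewrite exprn_ge0 //= mulrC ler_pdivlMr // mulrC ler_wpM2r ?exprn_ge0 //.
  by rewrite /step_size ler_pM2l // step_h_anti.
by move/cvg_norm_sqrt: h2; rewrite sqrtr0.
Qed.

Lemma iterate_residual_cvg0 (F : set_system nat) J : Filter F -> \oo `<=` F ->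
  F [set k | (cur_delay j k <= J)%N] -> u k - T (u k) @[k --> F] --> 0.
Proof.
move=> FF Foo FJ; apply/norm_cvg0P.
have h : `|residual E T j u k| + 2 * `|u k - delayed E u k (j k)| @[k --> F] --> (0 + 2 * 0 : R).
  by apply: cvgD; [exact: residual_cvg0 FJ|apply: cvgMl_tmp; exact: delay_error_cvg0 FJ].
rewrite mulr0 addr0 in h.
apply: (squeeze_cvgr _ (cvg_cst 0) h); apply: nearW => k.
by rewrite normr_ge0 /= residual_lipschitz.
Qed.

Lemma bounded_delay_weak_cvg :
  fixed_points T !=set0 ->
  (forall p, fixed_points T p -> cvgn (fun n => `|u n - p|)) ->
  exists2 xstar : H, fixed_points T xstar &
    forall J, (forall N, exists2 k, (N <= k)%N & (cur_delay j k <= J)%N) ->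
      weak_cvg dot (bounded_delay_subseq j J u) xstar.
Proof.
move=> Tne ucvg; have [p Tp hp] := opial hdot hT Tne ucvg.
exists p => // J hJ y.
have [inc rng] := bounded_delay_index_enum hJ.
set phi := bounded_delay_index j J in inc rng *.
have phige n : (n <= phi n)%N.
  elim: n => // n ih; apply: leq_ltn_trans ih _.
  by rewrite ltnNge; have := inc n.+1 n; rewrite !leEnat ltnn => ->.
have phioo : phi n @[n --> \oo] --> \oo.
  by move=> A [N _ NA]; exists N => // n /= Nn; apply: NA; exact: leq_trans (phige n).
(* Weak convergence of the subsequence is weak convergence of [u] along the image filter of
   [phi]. *)
apply: (hp (phi @ \oo)) => //; apply: (@iterate_residual_cvg0 _ J) => //.
by exists 0%N => // n _; have : range phi (phi n) by []; rewrite rng.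
Qed.

End Path.

(** The path up to time [k] is determined by the first [k] letters, so the Lyapunov function and its
    decrement become functions of words, to which the supermartingale results apply. *)
Lemma lyapunov_ae_cvg (d : measure_display) (Omega : measurableType d)
    (P : probability Omega R) (i : nat -> Omega -> 'I_m) (x0 : H)
    (x : nat -> Omega -> H) p :
  iid_uniform P i -> T p = p -> (forall w, x 0%N w = x0) ->
  (forall w k, x k.+1 w = update E T j eps c (x ^~ w) k (i k w)) ->
  (\forall w \ae P, cvgn (lyapunov m eps p (x ^~ w))) /\
  (\forall w \ae P, exists M, forall k, \sum_(n < k) g (x ^~ w) n <= M).
Proof.
move=> hi Tp x_0 xS.
have m0 : (0 < m)%N by have := card_alphabet_gt0 P i; rewrite card_ord.
pose V s := lyapunov m eps p (trajectory x0 s) (size s).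
pose G s := m%:R^-1 * (1 - c) * g (trajectory x0 s) (size s).
have trajE w k n : (n <= k)%N -> trajectory x0 (history (i ^~ w) k) n = x n w.
  by move=> nk; rewrite -(x_0 w); apply: (trajectory_history (u := x ^~ w)) nk => l; apply: xS.
have V0 s : 0 <= V s by apply: lyapunov_ge0.
have mc : 0 < m%:R^-1 * (1 - c) by rewrite mulr_gt0 ?invr_gt0 ?ltr0n ?subr_gt0.
have G0 s : 0 <= G s by rewrite mulr_ge0 // ltW.
have VG s : \sum_b V (b :: s) <= #|'I_m|%:R * (V s - G s).
  rewrite card_ord /G /g -(mulrA _ (1 - c)) [(1 - c) * _]mulrA mulrA.
  exact: lyapunov_descent.
split.
  have hV : supermartingale V.
    by move=> s; apply: le_trans (VG s) _; rewrite ler_wpM2l // gerBl.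
  have := supermartingale_ae_cvg hi V0 hV; apply: filterS => w.
  have -> // : (fun k => V (history (i ^~ w) k)) = lyapunov m eps p (x ^~ w).
  apply/funext => k; rewrite /V size_history; apply: lyapunov_ext => n.
  exact: trajE.
have := supermartingale_ae_sum hi V0 G0 VG; apply: filterS => w [M hM].
exists ((m%:R^-1 * (1 - c))^-1 * M) => k.
rewrite -ler_pdivrMl ?invr_gt0 // invrK mulr_sumr; apply: le_trans (hM k).
rewrite le_eqVlt; apply/orP; left; apply/eqP; apply: eq_bigr => n _.
rewrite /G /g size_history (residual_ext (v := x ^~ w)) // => l.
exact: trajE.
Qed.

End Pathwise.
End Trajectories.

Theorem theorem6
  (R : realType) (H : completeNormedModType R) (dot : {dot H for idfun})
  (hdot : induces_norm dot) (hsep : separable H)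
  (m : nat) (E : 'I_m -> set H) (hE : orthogonal_decomposition dot E)
  (T : H -> H) (hT : nonexpansive T) (hFix : fixed_points T !=set0)
  (d : measure_display) (Omega : measurableType d) (P : probability Omega R)
  (i : nat -> Omega -> 'I_m) (hi : iid_uniform P i)
  (j : nat -> 'I_m -> nat) (hj : (liminf_delay R j < +oo)%E)
  (eps : nat -> R) (heps_gt0 : forall l : nat, (0 < l)%N -> 0 < eps l)
  (heps_sum : cvgn (fun n => \sum_(1 <= l < n) eps l))
  (c : R) (hc0 : 0 < c) (hc1 : c < 1)
  (x0 : H) (x : nat -> Omega -> H)
  (hx : forall w : Omega,
     arock E (fun y => y - T y) x0 (fun k => c * step_h m eps (cur_delay j k))
       (i ^~ w) j (x ^~ w)) :
  {ae P, forall w : Omega,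
     exists2 xstar : H, fixed_points T xstar &
       forall J : nat, (liminf_delay R j <= J%:R%:E)%E ->
         weak_cvg dot (bounded_delay_subseq j J (x ^~ w)) xstar}.
Proof.
have x_0 w : x 0%N w = x0 by have [] := arock_update hdot hE (hx w).
have xS w k : x k.+1 w = update E T j eps c (x ^~ w) k (i k w).
  by have [_] := arock_update hdot hE (hx w); apply.
have [q [Tq qdense]] := countable_approx hsep hFix.
have ae_cvg p (Tp : T p = p) := lyapunov_ae_cvg hdot hE hT heps_gt0 heps_sum hc0 hc1 hi Tp x_0 xS.
(* The exceptional null set depends on the fixed point, hence the restriction to a countable dense
   family. *)
have cvg_q : \forall w \ae P, forall n, cvgn (lyapunov m eps (q n) (x ^~ w)).
  by apply: ae_forall_countable => n; have [] := ae_cvg _ (Tq n).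
(* The summed residuals do not involve the fixed point, so one member of the family suffices. *)
have [_ sum_g] := ae_cvg _ (Tq (0%N, 0%N)).
apply: filterS2 cvg_q sum_g => w cvg_q [M gM].
have dist_cvg p : fixed_points T p -> cvgn (fun n => `|x n w - p|).
  move=> Tp; apply: cvgn_dist_dense => e e0; have [n pq] := qdense p Tp e e0.
  exists (q n) => //.
  exact: (lyapunov_cvg_dist hdot hE heps_gt0 heps_sum hc0 hc1 (xS w) gM (cvg_q n)).
have [xstar Tx hJ] := bounded_delay_weak_cvg hdot hE hT heps_gt0 heps_sum hc0 hc1 (xS w) gM hFix dist_cvg.
exists xstar => // J lJ; apply: hJ; exact: frequently_le_liminf lJ.
Qed.
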